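(* Let $G$ be a group generated by a finite set $\{g_1,\dots,g_m\}\subset G$, and let $\psi_G: L_G\to G$ be a context-free Cayley automatic representation of $G$ with respect to $\{g_1,\dots,g_m\}$ such that the empty word is not in $L_G$. Suppose that for some constant $N$ the inequality $\bigl||u|-|v|\bigr|\leqslant N$ holds for all $u,v\in L_G$ and all $j\in\{1,\dots,m\}$ with $\psi_G(u)g_j=\psi_G(v)$. Let $F_n$ be the free group with free generators $a_1,\dots,a_n$, and consider $G\wr F_n$ with the generating set $S=\{g_1,\dots,g_m,a_1,\dots,a_n\}$. Let $K_0=|\psi_G^{-1}(e)|$, where $e\in G$ is the identity, and let $K=\max\{K_0+2(n-1),N\}$. Then there exists a context-free Cayley automatic representation $\psi: L\to G\wr F_n$ of the group $G\wr F_n$ (with respect to $S$) such that: (i) for every $g\in G\wr F_n$ and its representative $w=\psi^{-1}(g)$, $$\frac{1}{K}|w|-\frac{K_0}{K}\leqslant |g|;$$ (ii) if $C>0$ and $D\geqslant 0$ are such that $|g|\leqslant C|\psi_G^{-1}(g)|+D$ for all $g\in G$, then for every $g\in G\wr F_n$ and its representative $w=\psi^{-1}(g)$, $$|g|\leqslant (C+D+2)|w|-2.$$ Here $|g|$ denotes word length with respect to $\{g_1,\dots,g_m\}$ for $g\in G$, and with respect to $S$ for $g\in G\wr F_n$; for a word $w$, $|w|$ is its length.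
   Context: Wreath product: for groups $A,B$, let $A^{(B)}$ be the group of functions $B\to A$ with finite support (i.e. $f(x)\neq e$ for only finitely many $x$) under pointwise multiplication. For $f\in A^{(B)}$, $b\in B$ put $f^b(x)=f(bx)$. The restricted wreath product $A\wr B$ is the set of pairs $(f,b)$, $f\in A^{(B)}$, $b\in B$, with multiplication $(f,b)\cdot(f',b')=(f f'^{\,b^{-1}}, bb')$. The group $B$ is identified with the subgroup of elements $(\mathbf{e},b)$, where $\mathbf{e}$ is the identity of $A^{(B)}$; an element $c\in A$ is identified with $(f_c,e)$, where $f_c(e)=c$ and $f_c(x)=e$ for $x\neq e$. Convolution: for a finite alphabet $\Sigma$, let $\Sigma_\diamond=\Sigma\cup\{\diamond\}$ with $\diamond\notin\Sigma$. For $w_1,w_2\in\Sigma^*$, $w_1\otimes w_2$ is the word of length $\max\{|w_1|,|w_2|\}$ over $\Sigma_\diamond\times\Sigma_\diamond$ whose $k$th symbol is $(\sigma_1,\sigma_2)$, where $\sigma_i$ is the $k$th symbol of $w_i$ if $k\leqslant |w_i|$ and $\diamond$ otherwise. Context-free Cayley automatic representation: given a group $G$ and a finite generating set $S\subset G$, a context-free Cayley automatic representation of $G$ with respect to $S$ is a bijection $\psi:L\to G$, where $L\subset\Sigma^*$ is a context-free language over some finite alphabet $\Sigma$, such that for each $s\in S$ the language $L_s=\{w_1\otimes w_2 \mid w_1,w_2\in L,\ \psi(w_1)s=\psi(w_2)\}$ is context-free. (Context-free languages are those recognized by pushdown automata.) The word length $|g|$ with respect to a generating set $S$ is the least length of a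 word over $S\cup S^{-1}$ representing $g$. *)

(* Defs.v *)
From HB Require Import structures.
From mathcomp Require Import all_boot all_order all_algebra finmap.
From mathcomp Require Import boolp classical_sets functions reals.

Set Implicit Arguments.
Unset Strict Implicit.
Unset Printing Implicit Defensive.

Import Order.TTheory GRing.Theory Num.Theory.

Local Open Scope classical_set_scope.
Local Open Scope group_scope.

Section FinSuppFunctions.
Variables A B : groupType.
Implicit Types (f h : {fsfun B -> A with 1}) (b : B).

Definition fs_mul f h : {fsfun B -> A with 1} :=
  [fsfun x in (finsupp f `|` finsupp h)%fset => f x * h x | 1].

Definition fs_inv f : {fsfun B -> A with 1} :=
  [fsfun x in finsupp f => (f x)^-1 | 1].

(* [fs_act f b] is the function f^b : x |-> f (b x), see [fs_actE]. *)
Definition fs_act f b : {fsfun B -> A with 1} :=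
  [fsfun x in [fset b^-1 * y | y in finsupp f]%fset => f (b * x) | 1].

Definition fs_single (c : A) : {fsfun B -> A with 1} :=
  [fsfun x in [fset (1 : B)]%fset => c | 1].

Lemma fs_mulE f h x : fs_mul f h x = f x * h x.
Proof.
rewrite fsfunE in_fsetU; case: (finsuppP f x) => [_|//].
by case: (finsuppP h x) => [_|//]; rewrite mulg1.
Qed.

Lemma fs_invE f x : fs_inv f x = (f x)^-1.
Proof. by rewrite fsfunE; case: (finsuppP f x) => [_|//]; rewrite invg1. Qed.

Lemma fs_actE f b x : fs_act f b x = f (b * x).
Proof.
rewrite fsfunE; case: ifPn => // /imfsetP nx.
case: (finsuppP f (b * x)) => // bx; case: nx; exists (b * x) => //.
by rewrite mulKg.
Qed.

Lemma fs_singleE c x : fs_single c x = if x == 1 then c else 1.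
Proof. by rewrite fsfunE in_fset1. Qed.

End FinSuppFunctions.

Record wreath (A B : groupType) := Wreath {
  wr_fun : {fsfun B -> A with 1};
  wr_pos : B
}.

Section WreathGroup.
Variables A B : groupType.
Local Notation W := (wreath A B).
Implicit Types u v w : W.

Definition wr_pair u := (wr_fun u, wr_pos u).
Definition wr_unpair (p : {fsfun B -> A with 1} * B) : W := Wreath p.1 p.2.
Lemma wr_pairK : cancel wr_pair wr_unpair. Proof. by case. Qed.

HB.instance Definition _ := Choice.copy W (can_type wr_pairK).

Definition wr_one : W := Wreath [fsfun of _ => 1] 1.

Definition wr_mul u v : W :=
  Wreath (fs_mul (wr_fun u) (fs_act (wr_fun v) (wr_pos u)^-1))
         (wr_pos u * wr_pos v).

Definition wr_inv u : W :=
  Wreath (fs_act (fs_inv (wr_fun u)) (wr_pos u)) (wr_pos u)^-1.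

Lemma wr_eq u v : wr_fun u =1 wr_fun v -> wr_pos u = wr_pos v -> u = v.
Proof. by case: u v => [f b] [h c] /= /fsfunP-> ->. Qed.

Lemma wr_mulA : associative wr_mul.
Proof.
move=> u v w; apply: wr_eq => [x|] /=; last exact: mulgA.
by rewrite !(fs_mulE, fs_actE) invgM !mulgA.
Qed.

Lemma wr_mul1 : left_id wr_one wr_mul.
Proof.
move=> u; apply: wr_eq => [x|] /=; last exact: mul1g.
by rewrite !(fs_mulE, fs_actE) fsfunE invg1 !mul1g.
Qed.

Lemma wr_mulg1 : right_id wr_one wr_mul.
Proof.
move=> u; apply: wr_eq => [x|] /=; last exact: mulg1.
by rewrite !(fs_mulE, fs_actE) fsfunE mulg1.
Qed.

Lemma wr_mulV : left_inverse wr_one wr_inv wr_mul.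
Proof.
move=> u; apply: wr_eq => [x|] /=; last exact: mulVg.
by rewrite !(fs_mulE, fs_actE, fs_invE) fsfunE invgK mulVg.
Qed.

Lemma wr_mulgV : right_inverse wr_one wr_inv wr_mul.
Proof.
move=> u; apply: wr_eq => [x|] /=; last exact: mulgV.
by rewrite !(fs_mulE, fs_actE, fs_invE) fsfunE mulVKg mulgV.
Qed.

HB.instance Definition _ :=
  isGroup.Build W wr_mulA wr_mul1 wr_mulg1 wr_mulV wr_mulgV.

Definition wr_lamp (c : A) : W := Wreath (fs_single B c) 1.
Definition wr_shift (b : B) : W := Wreath [fsfun of _ => 1] b.

End WreathGroup.

Section FreeGroup.
Variable n : nat.

(* The letter (i, true) stands for a_i, and (i, false) for its inverse. *)
Definition letter := ('I_n * bool)%type.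
Implicit Types (x y : letter) (s t : seq letter).

Definition letter_inv x : letter := (x.1, ~~ x.2).

Definition reduced s : bool := sorted (fun x y => y != letter_inv x) s.

Record free_group := FreeGroup { fg_word :> seq letter; _ : reduced fg_word }.

HB.instance Definition _ := [isSub for fg_word].
HB.instance Definition _ := [Choice of free_group by <:].

Lemma letter_invK : involutive letter_inv.
Proof. by case=> i b; rewrite /letter_inv /= negbK. Qed.

Definition fg_push x s : seq letter :=
  if s is y :: s' then if y == letter_inv x then s' else x :: s else [:: x].

Definition fg_cat s t : seq letter := foldr fg_push t s.

Lemma reduced_behead x s : reduced (x :: s) -> reduced s.
Proof. exact: path_sorted. Qed.

Lemma fg_push_reduced x s : reduced s -> reduced (fg_push x s).
Proof.
case: s => //= y s; case: ifP => [_|nyx rs]; first exact: path_sorted.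
by rewrite /reduced /= nyx.
Qed.

Lemma fg_cat_reduced s t : reduced t -> reduced (fg_cat s t).
Proof. by move=> rt; elim: s => //= x s; apply: fg_push_reduced. Qed.

Lemma fg_pushK x s : reduced s -> fg_push x (fg_push (letter_inv x) s) = s.
Proof.
case: s => [|y s] /=; first by rewrite eqxx.
rewrite letter_invK; case: eqP => [->|_ _]; last by rewrite /= eqxx.
by case: s => //= z s /andP[/negPf-> _].
Qed.

Lemma fg_cat_push x s t :
  reduced t -> fg_cat (fg_push x s) t = fg_push x (fg_cat s t).
Proof.
move=> rt; case: s => //= y s; case: eqP => //= ->.
by rewrite fg_pushK // fg_cat_reduced.
Qed.

Lemma fg_catA s t r :
  reduced r -> fg_cat s (fg_cat t r) = fg_cat (fg_cat s t) r.
Proof. by move=> rr; elim: s => //= x s ->; rewrite fg_cat_push. Qed.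

Lemma fg_cats0 s : reduced s -> fg_cat s [::] = s.
Proof.
elim: s => //= x s IHs rs; rewrite IHs ?(reduced_behead rs) //.
by case: s rs {IHs} => //= y s /andP[/negPf->].
Qed.

Definition word_inv s := rev (map letter_inv s).

Lemma reduced_inv s : reduced s -> reduced (word_inv s).
Proof.
rewrite /reduced /word_inv rev_sorted sorted_map; apply: sub_sorted => x y /=.
by apply: contraNN => /eqP/(can_inj letter_invK)->; rewrite letter_invK.
Qed.

Lemma fg_catV s t : reduced t -> fg_cat (word_inv s) (fg_cat s t) = t.
Proof.
move=> rt; rewrite /word_inv; elim: s => //= x s IHs.
rewrite rev_cons -cats1 /fg_cat foldr_cat /= -{2}(letter_invK x).
by rewrite fg_pushK ?fg_cat_reduced // IHs.
Qed.

Lemma word_invK s : word_inv (word_inv s) = s.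
Proof.
by rewrite /word_inv map_rev revK -map_comp map_id_in // => x _; apply: letter_invK.
Qed.

Definition fg_one : free_group := @FreeGroup [::] isT.
Definition fg_mul (u v : free_group) : free_group :=
  FreeGroup (fg_cat_reduced u (valP v)).
Definition fg_inv (u : free_group) : free_group :=
  FreeGroup (reduced_inv (valP u)).

Lemma fg_mulA : associative fg_mul.
Proof. by move=> u v w; apply/val_inj/fg_catA/valP. Qed.

Lemma fg_mul1 : left_id fg_one fg_mul.
Proof. by move=> u; apply: val_inj. Qed.

Lemma fg_mulg1 : right_id fg_one fg_mul.
Proof. by move=> u; apply/val_inj/fg_cats0/valP. Qed.

Lemma fg_mulV : left_inverse fg_one fg_inv fg_mul.
Proof.
move=> u; apply: val_inj => /=.
by rewrite -[X in fg_cat _ X](fg_cats0 (valP u)) fg_catV.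
Qed.

Lemma fg_mulgV : right_inverse fg_one fg_inv fg_mul.
Proof.
move=> u; apply: val_inj => /=; rewrite -[X in fg_cat X _]word_invK.
rewrite -[X in fg_cat _ X](fg_cats0 (reduced_inv (valP u))).
by rewrite fg_catV.
Qed.

HB.instance Definition _ :=
  isGroup.Build free_group fg_mulA fg_mul1 fg_mulg1 fg_mulV fg_mulgV.

Definition free_gen (i : 'I_n) : free_group := @FreeGroup [:: (i, true)] isT.

End FreeGroup.

Section WordLength.
Variables (G : groupType) (I : finType) (g : I -> G).

(* Words over S u S^-1, where S is the range of g. *)
Definition word_eval (w : seq (I * bool)) : G :=
  \prod_(x <- w) (if x.2 then g x.1 else (g x.1)^-1).

Definition generates : Prop := forall x : G, exists w, word_eval w = x.

(* 0 by convention when x is not in the subgroup generated by g. *)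
Definition word_length (x : G) : nat :=
  xget 0%N [set k | (exists2 w, word_eval w = x & size w = k) /\
                    (forall w, word_eval w = x -> (k <= size w)%N)].

End WordLength.

(* Nondeterministic pushdown automata: in state q with z on top of the stack,
   for each (q', zs) in [pda_trans q a z] the automaton may consume a (nothing
   if a = None), replace z by the word zs and enter q'. *)
Record pda (T : finType) := Pda {
  pda_state : finType;
  pda_stack : finType;
  pda_init : pda_state;
  pda_bottom : pda_stack;
  pda_final : {set pda_state};
  pda_trans : pda_state -> option T -> pda_stack ->
              seq (pda_state * seq pda_stack)
}.

Inductive pda_accepts (T : finType) (M : pda T) :
    pda_state M -> seq (pda_stack M) -> seq T -> Prop :=
| Pda_final q zs of q \in pda_final M : pda_accepts q zs [::]
| Pda_read q z zs a w q' zs' of (q', zs') \in pda_trans q (Some a) z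
    & pda_accepts q' (zs' ++ zs) w : pda_accepts q (z :: zs) (a :: w)
| Pda_eps q z zs w q' zs' of (q', zs') \in pda_trans q None z
    & pda_accepts q' (zs' ++ zs) w : pda_accepts q (z :: zs) w.

Definition context_free (T : finType) (L : set (seq T)) : Prop :=
  exists M : pda T,
    L = [set w | pda_accepts (pda_init M) [:: pda_bottom M] w].

(* [None] plays the role of the padding symbol. *)
Definition convolution (T : Type) (w1 w2 : seq T) : seq (option T * option T) :=
  mkseq (fun k => (onth w1 k, onth w2 k)) (maxn (size w1) (size w2)).

(* Only the restriction of psi to L is relevant. *)
Definition cf_cayley_representation (G : groupType) (I : finType) (g : I -> G)
    (T : finType) (L : set (seq T)) (psi : seq T -> G) : Prop :=
  [/\ generates g,
      context_free L,
      set_bij L [set: G] psi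
    & forall i : I, context_free
        [set w : seq (option T * option T) | exists w1 w2,
          [/\ L w1, L w2, psi w1 * g i = psi w2 & w = convolution w1 w2]]].

Definition wreath_gens (G : groupType) (m n : nat) (g : 'I_m -> G)
    (i : 'I_m + 'I_n) : wreath G (free_group n) :=
  match i with
  | inl j => wr_lamp (free_group n) (g j)
  | inr k => wr_shift G (free_gen k)
  end.

(* Main.v *)
Require Import Defs.
From HB Require Import structures.
From mathcomp Require Import all_boot all_order all_algebra finmap.
From mathcomp Require Import boolp classical_sets functions reals.
From mathcomp Require Import zify lra.

Set Implicit Arguments.
Unset Strict Implicit.
Unset Printing Implicit Defensive.

Import Order.TTheory GRing.Theory Num.Theory.

Local Open Scope classical_set_scope.

(** An element (f, z) of the wreath product is represented by a finite subtree of
    the Cayley tree of the free group: the smallest one that contains the unit,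
    the support of f and z. The code of the tree lists its vertices in preorder;
    each vertex v contributes the representative of f(v), a nonempty word, whose
    first letter carries the direction from the parent, whether v = z, whether v
    has children and whether it has later siblings. These flags determine the
    shape of the tree, so the code is uniquely readable ([enc_inj]) although its
    length is just the sum of the lengths of the labels, and minimality of the
    tree makes the representation injective ([valid_ext], [denotes_inj]).

    Lengths. Multiplying by a generator of G replaces one label, whose length
    changes by at most N. Multiplying by a free generator moves the position; at
    worst it creates or deletes one leaf labelled by the representative of e,
    which costs K0. As the code of the unit has length K0, induction along a
    shortest word for the element bounds the length of its code
    ([word_represented], [wr_size_le]). Conversely, a depth-first tour of the tree
    that visits the branch with z last crosses each edge at most twice; the tree has
    fewer edges than vertices and labels are nonempty, which bounds the word length
    by the length of the code ([tour_root], [wr_length_le]).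

    Context-freeness. For a generator s, consider the pairs of trees that
    represent x and xs. They differ locally, and the relation between them is
    generated by finitely many rules on vertices ([edits]). If the two codes are
    aligned vertex by vertex, with padding only inside the edited label, the
    aligned words are generated by a grammar with rules X -> a Y Z in which the
    terminal a stands for an arbitrary word of a context-free language: the labels
    of G or a multiplication language of G ([gen_edits], [context_free_gen]). The
    number of padding symbols is bounded, so a finite transducer with a bounded
    buffer moves them to the end ([context_free_convolution]), which gives the
    multiplication languages. Moves along an inverse letter are the same pairs
    read in the opposite order, and the language of codes is a projection of a
    multiplication language. *)

(** * Closure properties of context-free languages *)

Section PdaSteps.
Variables (T : finType) (M : pda T).
Implicit Types (p q : pda_state M) (zs : seq (pda_stack M)).

Lemma pda_step q o z p zs' zs w :
  (p, zs') \in pda_trans q o z -> pda_accepts p (zs' ++ zs) w ->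
  pda_accepts q (z :: zs) (seq_of_opt o ++ w).
Proof. by case: o => [a|]; [apply: Pda_read | apply: Pda_eps]. Qed.

(** Reading moves and silent moves are alike for most invariants, so the two
    inductive cases are merged. *)
Lemma pda_accepts_ind' (P : pda_state M -> seq (pda_stack M) -> seq T -> Prop) :
  (forall q zs, q \in pda_final M -> P q zs [::]) ->
  (forall q o z zs w p zs', (p, zs') \in pda_trans q o z ->
     pda_accepts p (zs' ++ zs) w -> P p (zs' ++ zs) w ->
     P q (z :: zs) (seq_of_opt o ++ w)) ->
  forall q zs w, pda_accepts q zs w -> P q zs w.
Proof.
move=> Pf Ps q zs w; elim=> [|{}q z {}zs a {}w p zs'|{}q z {}zs {}w p zs'].
- by move=> {}q {}zs; apply: Pf.
- exact: (Ps _ (Some a)).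
- exact: (Ps _ None).
Qed.

End PdaSteps.

Lemma context_freeP (T : finType) (L : set (seq T)) :
  context_free L <-> exists M : pda T, forall w,
    L w <-> pda_accepts (pda_init M) [:: pda_bottom M] w.
Proof.
split=> -[M LM]; exists M; first by move=> w; rewrite LM.
by apply/seteqP; split=> w /LM.
Qed.

Lemma eq_context_free (T : finType) (L1 L2 : set (seq T)) :
  (forall w, L1 w <-> L2 w) -> context_free L1 -> context_free L2.
Proof. by move=> /(@predeqP _ L1 L2) ->. Qed.

(** A finite-state transducer with silent moves on both sides. One closure
    theorem for these replaces separate ones for homomorphisms, intersections
    with regular languages and rearrangements within a bounded window. *)
Record transducer (A B : finType) := Transducer {
  tr_state : finType;
  tr_init : tr_state;
  tr_final : tr_state -> Prop;
  tr_step : tr_state -> option A -> option B -> tr_state -> Prop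
}.

Inductive tr_run (A B : finType) (T : transducer A B) :
    tr_state T -> seq A -> seq B -> Prop :=
| Run_final r of tr_final r : tr_run r [::] [::]
| Run_step r a b r' w v of tr_step r a b r' & tr_run r' w v :
    tr_run r (seq_of_opt a ++ w) (seq_of_opt b ++ v).

Section Transduction.
Variables (A B : finType) (M : pda A) (T : transducer A B).

(** [None] is a bottom marker below the stack of [M]: the transducer must be
    able to move after [M] has emptied its stack. The initial state [None]
    installs it. *)
Definition tr_pda_trans (q : option (pda_state M * tr_state T)) (o : option B)
    (z : option (pda_stack M)) :=
  match q with
  | None => if o is None
            then [:: (Some (pda_init M, tr_init T), [:: Some (pda_bottom M); None])]
            else [::]
  | Some (p, r) =>
      [seq (Some (p, r'), [:: z]) | r' <- enum (tr_state T) & `[< tr_step r None o r' >]] ++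
      (if z is Some z' then
         (if o is None
          then [seq (Some (x.1, r), map Some x.2) | x <- pda_trans p None z']
          else [::]) ++
         [seq (Some (x.1, ar.2), map Some x.2)
         | ar <- [seq ar <- enum {: A * tr_state T} | `[< tr_step r (Some ar.1) o ar.2 >]],
           x <- pda_trans p (Some ar.1) z']
       else [::])
  end.

Definition tr_pda : pda B :=
  @Pda B (option (pda_state M * tr_state T)) (option (pda_stack M)) None None
    [set q | if q is Some (p, r) then (p \in pda_final M) && `[< tr_final r >] else false]
    tr_pda_trans.

(** The run of the automaton drives the induction; the moves of the transducer
    that read nothing are inserted between its steps. *)
Lemma tr_pda_complete p zs w : pda_accepts p zs w ->
  forall r v, tr_run r w v ->
  @pda_accepts B tr_pda (Some (p, r)) (map Some zs ++ [:: None]) v.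
Proof.
have run_top q z zs' w' : (forall r v, tr_run r w' v ->
    (forall r1 a b r2 w1 v1, w' = a :: w1 -> tr_step r1 (Some a) b r2 ->
       tr_run r2 w1 v1 ->
       @pda_accepts B tr_pda (Some (q, r1)) (z :: zs') (seq_of_opt b ++ v1)) ->
    (forall r1, w' = [::] -> tr_final r1 ->
       @pda_accepts B tr_pda (Some (q, r1)) (z :: zs') [::]) ->
    @pda_accepts B tr_pda (Some (q, r)) (z :: zs') v).
  move=> r v; elim=> [{}r rf _ /(_ _ erefl rf)//|{}r [a|] b r' {}w' {}v rr' r'w IH H1 H2].
    exact: (H1 _ _ _ _ _ _ erefl rr').
  apply: (@pda_step B tr_pda _ _ _ (Some (q, r')) [:: z]); last exact: IH.
  rewrite /= mem_cat; apply/orP; left; apply/mapP; exists r' => //.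
  by rewrite mem_filter mem_enum andbT; apply/asboolP.
elim/pda_accepts_ind' => [q {}zs qf|q [a|] z {}zs {}w q' zs' tq _ IH] r v.
- case E: (map Some zs ++ [:: None]) => [|z zs']; first by case: (zs) E.
  move=> rv; apply: run_top rv _ _ => [//|r1 _ rf].
  by apply: Pda_final; rewrite inE qf; apply/asboolP.
- move=> rv; apply: run_top rv _ _ => [r1 _ b r2 _ v1 [<- <-] r12 rv1|//].
  apply: (@pda_step B tr_pda _ _ _ (Some (q', r2)) (map Some zs')).
    rewrite /= !mem_cat; apply/orP; right; apply/orP; right.
    apply/allpairsPdep; exists (a, r2), (q', zs'); split=> //.
    by rewrite mem_filter mem_enum andbT; apply/asboolP.
  by rewrite catA -map_cat; apply: IH.
- move=> rv; apply: (@pda_step B tr_pda _ None _ (Some (q', r)) (map Some zs')).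
    rewrite /= !mem_cat; apply/orP; right; apply/orP; left.
    by apply/mapP; exists (q', zs').
  by rewrite catA -map_cat; apply: IH.
Qed.

Lemma tr_pda_sound q zs v : @pda_accepts B tr_pda q zs v ->
  match q with
  | Some (p, r) => forall zs0, zs = map Some zs0 ++ [:: None] ->
      exists2 w, pda_accepts p zs0 w & tr_run r w v
  | None => zs = [:: None] -> exists2 w, pda_accepts (pda_init M) [:: pda_bottom M] w &
      tr_run (tr_init T) w v
  end.
Proof.
elim/pda_accepts_ind' => [[[p r]|] {}zs|[[p r]|] o z {}zs {}v q' zs'] //.
- rewrite inE => /andP[pf /asboolP rf] zs0 _.
  by exists [::]; [apply: Pda_final | apply: Run_final].
- by rewrite inE.
- rewrite mem_cat => /orP[/mapP[r']|].
    rewrite mem_filter mem_enum andbT => /asboolP rr' [-> ->] _ IH zs0 E.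
    have [w pw rw] := IH zs0 E.
    by exists w => //; apply: (@Run_step _ _ T _ None _ _ _ _ rr' rw).
  case: z => [z|//]; rewrite mem_cat => /orP[|].
    case: o => [//|] /mapP[[p' zs1] tp [-> ->]] _ IH [//|_ zs0 [<- E]].
    have [|w pw rw] := IH (zs1 ++ zs0); first by rewrite E catA -map_cat.
    by exists w => //; apply: Pda_eps tp pw.
  move=> /allpairsPdep[[a r'] [[p' zs1]]].
  rewrite mem_filter mem_enum andbT => -[/asboolP rr' tp [-> ->]] _ IH [//|_ zs0 [<- E]].
  have [|w pw rw] := IH (zs1 ++ zs0); first by rewrite E catA -map_cat.
  exists (a :: w); first exact: Pda_read tp pw.
  exact: (@Run_step _ _ T _ (Some a) _ _ _ _ rr' rw).
- case: o => [//|]; rewrite inE => /eqP[-> ->] _ IH [_ zs0].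
  by apply: (IH [:: pda_bottom M]); rewrite zs0.
Qed.

End Transduction.

(** The product of the automaton with the transducer guesses the input of the
    transducer while it reads the output. *)
Theorem context_free_transduce (A B : finType) (T : transducer A B)
    (L : set (seq A)) :
  context_free L ->
  context_free [set v | exists2 w, L w & tr_run (tr_init T) w v].
Proof.
move=> /context_freeP[M LM]; apply/context_freeP; exists (tr_pda M T) => v; split.
  move=> [w /LM Mw Tw].
  apply: (@pda_step B (tr_pda M T) None None None (Some (pda_init M, tr_init T))
            [:: Some (pda_bottom M); None]) => //.
  - by rewrite inE.
  - exact: (tr_pda_complete Mw Tw).
by move=> /tr_pda_sound -/(_ erefl)[w Mw Tw]; exists w; [apply/LM|].
Qed.

Section SubstitutedGrammar.
Variables (NT A B : finType).
Variables (nullable : NT -> Prop) (rule : NT -> A -> NT -> NT -> Prop).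
Variable La : A -> set (seq B).

(** The language of a nonterminal for the rules X -> a Y Z and X -> epsilon,
    each terminal a standing for an arbitrary word of its own language. *)
Inductive gen : NT -> seq B -> Prop :=
| Gen_nil X of nullable X : gen X [::]
| Gen_rule X a Y Z w0 w1 w2 of rule X a Y Z & La a w0 & gen Y w1 & gen Z w2 :
    gen X (w0 ++ w1 ++ w2).

Fixpoint gens (Xs : seq NT) (w : seq B) : Prop :=
  if Xs is X :: Xs' then exists w1 w2, [/\ w = w1 ++ w2, gen X w1 & gens Xs' w2]
  else w = [::].

Variables (M : A -> pda B) (X0 : NT).
Hypothesis LaM : forall a w,
  La a w <-> pda_accepts (pda_init (M a)) [:: pda_bottom (M a)] w.

Local Notation inner_state := {a : A & pda_state (M a)}.
Local Notation inner_stack := {a : A & pda_stack (M a)}.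
(* The two Boolean states are the initial and the accepting one; then [None]
   is the state that expands nonterminals, and [Some (Tagged _ p)] runs the
   automaton of a terminal. *)
Local Notation state := (bool + option inner_state)%type.
Local Notation stack := (option (NT + inner_stack)).

Definition inner a (z : pda_stack (M a)) : stack :=
  Some (inr (Tagged (fun a => pda_stack (M a)) z)).
Definition run_inner a (p : pda_state (M a)) : state :=
  inr (Some (Tagged (fun a => pda_state (M a)) p)).

Definition gen_trans (q : state) (o : option B) (z : stack) : seq (state * seq stack) :=
  match q with
  | inl b => if ~~ b && (o == None) then [:: (inr None, [:: Some (inl X0); None])] else [::]
  | inr None => if o is None then
      match z with
      | None => [:: (inl true, [::])]
      | Some (inl X) =>
          (if `[< nullable X >] then [:: (inr None, [::])] else [::]) ++
          [seq (run_inner (pda_init (M x.1.1)),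
                [:: inner (pda_bottom (M x.1.1)); Some (inl x.1.2); Some (inl x.2)])
          | x <- enum {: A * NT * NT} & `[< rule X x.1.1 x.1.2 x.2 >]]
      | Some (inr _) => [:: (inr None, [::])]
      end else [::]
  | inr (Some (existT a p)) =>
      (if z is Some (inr s) then
         if tag s == a then
           [seq (run_inner x.1, map (@inner a) x.2)
           | x <- pda_trans p o (tagged_as (Tagged (fun a => pda_stack (M a)) (pda_bottom (M a))) s)]
         else [::]
       else [::]) ++
      (if (o == None) && (p \in pda_final (M a)) then [:: (inr None, [:: z])] else [::])
  end.

Definition gen_pda : pda B :=
  @Pda B state stack (inl false) None [set inl true] gen_trans.

Local Notation outer Xs := (map (fun X => Some (inl X) : stack) Xs ++ [:: None]).

(** An inner automaton may accept with a nonempty stack; what it leaves there is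
    discarded before the next nonterminal is expanded. *)
Lemma gen_pda_pop (ss : seq inner_stack) zs w :
  @pda_accepts B gen_pda (inr None) zs w ->
  @pda_accepts B gen_pda (inr None) (map (fun s => Some (inr s)) ss ++ zs) w.
Proof.
move=> H; elim: ss => //= s ss IH.
by apply: (@pda_step B gen_pda _ None _ (inr None) [::]) IH; rewrite inE.
Qed.

Lemma gen_pda_run a p zs w0 z zs1 w : @pda_accepts B (M a) p zs w0 ->
  @pda_accepts B gen_pda (inr None) (z :: zs1) w ->
  @pda_accepts B gen_pda (run_inner p) (map (@inner a) zs ++ z :: zs1) (w0 ++ w).
Proof.
move=> Mp Hw; elim/pda_accepts_ind': Mp => {p zs w0} [p zs pf|p o z' zs w0 p' zs' tp _ IH].
- have H := gen_pda_pop (map (fun z => Tagged (fun a => pda_stack (M a)) z) zs) Hw.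
  rewrite -map_comp in H; case: zs H => [|z0 zs] /= H.
    apply: (@pda_step B gen_pda _ None _ (inr None) [:: z]) Hw.
    by rewrite mem_cat pf; apply/orP; right; rewrite inE.
  apply: (@pda_step B gen_pda _ None _ (inr None) [:: inner z0]) H.
  by rewrite mem_cat pf; apply/orP; right; rewrite inE.
- rewrite /= -catA.
  apply: (@pda_step B gen_pda _ _ _ (run_inner p') (map (@inner a) zs')).
    rewrite /= mem_cat; apply/orP; left; rewrite eqxx tagged_asE.
    by apply/mapP; exists (p', zs').
  by rewrite catA -map_cat.
Qed.

Lemma gen_pda_outer X w0 : gen X w0 -> forall zs w,
  @pda_accepts B gen_pda (inr None) zs w ->
  @pda_accepts B gen_pda (inr None) (Some (inl X) :: zs) (w0 ++ w).
Proof.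
elim=> {X w0} [X nX|X a Y Z w0 w1 w2 r /LaM Lw0 _ IH1 _ IH2] zs w Hw.
  apply: (@pda_step B gen_pda _ None _ (inr None) [::]) Hw.
  by rewrite /= mem_cat asboolT // inE eqxx.
apply: (@pda_step B gen_pda _ None _ (run_inner (pda_init (M a)))
  [:: inner (pda_bottom (M a)); Some (inl Y); Some (inl Z)]).
  rewrite /= mem_cat; apply/orP; right; apply/mapP; exists (a, Y, Z) => //.
  by rewrite mem_filter mem_enum andbT; apply/asboolP.
by rewrite -!catA; apply: (gen_pda_run Lw0 (IH1 _ _ (IH2 _ _ Hw))).
Qed.

(** What a configuration accepts: the word of the running inner automaton, then
    the words of the nonterminals that wait on the stack. *)
Lemma gen_pda_sound q zs w : @pda_accepts B gen_pda q zs w ->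
  match q with
  | inl true => w = [::]
  | inl false => zs = [:: None] -> gen X0 w
  | inr None => forall ss Xs, zs = map (fun s => Some (inr s)) ss ++ outer Xs -> gens Xs w
  | inr (Some (existT a p)) => forall zs0 Xs, zs = map (@inner a) zs0 ++ outer Xs ->
      exists w1 w2, [/\ w = w1 ++ w2, pda_accepts p zs0 w1 & gens Xs w2]
  end.
Proof.
elim/pda_accepts_ind' => [[[]|[[a p]|]] {}zs|[[]|[[a p]|]] o z {}zs {}w q' zs'] //;
  do ?by rewrite inE.
- rewrite /=; case: o => //; rewrite inE => /eqP[-> ->] _ IH [_ zs0].
  have [|w1 [w2 [-> g1 ->]]] := IH [::] [:: X0]; first by rewrite zs0.
  by rewrite cats0.
- rewrite mem_cat => /orP[|].
    case: z => [[//|[a' z]]|//] /=; case: eqP => // ea; subst a'.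
    rewrite tagged_asE => /mapP[[p' zs1] tp [-> ->]] _ IH [|z0 zs0] Xs /=.
      by case: Xs.
    move=> [/eqP]; rewrite eq_Tagged /= => /eqP <- E.
    have [|w1 [w2 [-> Mw1 g2]]] := IH (zs1 ++ zs0) Xs; first by rewrite E map_cat catA.
    by exists (seq_of_opt o ++ w1), w2; rewrite catA; split=> //; apply: pda_step tp Mw1.
  case: o => //; case: ifP => // pf; rewrite inE => /eqP[-> ->] _ IH zs0 Xs E.
  exists [::], w; split=> //; first exact: Pda_final.
  apply: (IH (map (fun z => Tagged (fun a => pda_stack (M a)) z) zs0)).
  by rewrite -map_comp; apply: E.
- case: o => //; case: z => [[X|s]|]; last 1 first.
  + rewrite inE => /eqP[-> ->] _ IH [|//] [|//] _ //.
  + rewrite mem_cat => /orP[|].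
      case: asboolP => // nX; rewrite inE => /eqP[-> ->] _ IH [|//] [|Y Xs] //= [<- E].
      by exists [::], w; split=> //; [apply: Gen_nil | apply: (IH [::])].
    move=> /mapP[[[a Y] Z]]; rewrite mem_filter mem_enum andbT => /asboolP r [-> ->].
    move=> _ IH [|//] [|X' Xs] //= [<- E].
    have [|w0 [w1 [-> Mw0 [w2 [w3 [-> g2 [w4 [w5 [-> g4 g5]]]]]]]]] :=
      IH [:: pda_bottom (M a)] [:: Y, Z & Xs]; first by rewrite E.
    exists (w0 ++ w2 ++ w4), w5; split=> //; first by rewrite !catA.
    by apply: Gen_rule r _ g2 g4; apply/LaM.
  + rewrite inE => /eqP[-> ->] _ IH [|s' ss] Xs; first by case: Xs.
    by move=> [_ E]; apply: (IH ss).
Qed.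

Lemma gen_pdaP w : gen X0 w <-> @pda_accepts B gen_pda (inl false) [:: None] w.
Proof.
split=> [g|/gen_pda_sound]; last exact.
apply: (@pda_step B gen_pda _ None _ (inr None) [:: Some (inl X0); None]).
  by rewrite /= inE.
rewrite -[w]cats0; apply: (gen_pda_outer g).
apply: (@pda_step B gen_pda _ None _ (inl true) [::]); first by rewrite /= inE.
by apply: Pda_final; rewrite inE.
Qed.

End SubstitutedGrammar.

(** The automaton performs a leftmost derivation on its stack and, on top of the
    waiting nonterminals, runs the automaton of the current terminal. *)
Theorem context_free_gen (NT A B : finType) (nullable : NT -> Prop)
    (rule : NT -> A -> NT -> NT -> Prop) (La : A -> set (seq B)) X :
  (forall a, context_free (La a)) -> context_free (gen nullable rule La X).
Proof.
move=> cfL; have /choice[M LaM] := fun a => (context_freeP (La a)).1 (cfL a).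
by apply/context_freeP; exists (gen_pda nullable rule M X) => w; apply: gen_pdaP.
Qed.

(** A union is generated by a grammar whose start symbol derives either of two
    substituted terminals. *)
Lemma context_freeU (T : finType) (L1 L2 : set (seq T)) :
  context_free L1 -> context_free L2 -> context_free (L1 `|` L2).
Proof.
move=> cf1 cf2; pose La (b : bool) := if b then L1 else L2.
pose rule (X : bool) (b : bool) Y Z := [/\ X, ~~ Y & ~~ Z].
have cfa b : context_free (La b) by case: b.
apply: eq_context_free (context_free_gen (fun X => ~~ X) rule true cfa) => w.
have gen_false v : gen (fun X => ~~ X) rule La false v -> v = [::].
  by move E: false => X g; case: g E => [//|X0 b Y Z w0 w1 w2 [+ _ _] _ _ _ E]; rewrite -E.
split.
  move E: true => X g; case: g E => {X w} [X + E|X b Y Z w0 w1 w2]; first by rewrite -E.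
  move=> [_ /negPf-> /negPf->] Lw /gen_false-> /gen_false-> _.
  by rewrite !cats0; case: b Lw => ?; [left|right].
move=> Lw; have [b Lb] : exists b, La b w by case: Lw => ?; [exists true|exists false].
rewrite -[w]cats0 -[[::]]cats0.
by apply: (@Gen_rule _ _ _ _ rule La true b false false) => //; apply: Gen_nil.
Qed.

(** A letter-to-letter map that treats the first letter separately; it is used to
    attach flags to the beginning of a label. *)
Definition mark_head (A B : Type) (h0 h1 : A -> B) (w : seq A) : seq B :=
  if w is a :: w' then h0 a :: map h1 w' else [::].

Lemma map_mark_head (A B : Type) (h : A -> B) : map h =1 mark_head h h.
Proof. by case. Qed.

Lemma context_free_mark_head (A B : finType) (h0 h1 : A -> B) (L : set (seq A)) :
  context_free L -> context_free (mark_head h0 h1 @` L).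
Proof.
pose T := @Transducer A B bool true (fun _ => True)
  (fun r a b r' => [/\ r' = false, isSome a & b = omap (if r then h0 else h1) a]).
move=> /(context_free_transduce T); apply: eq_context_free => v.
have run_head r w : tr_run (T := T) r w ((if r then mark_head h0 h1 else map h1) w).
  elim: w r => [|a w IH] r; first by case: r; apply: Run_final.
  suff -> : (if r then mark_head h0 h1 else map h1) (a :: w) =
      seq_of_opt (Some ((if r then h0 else h1) a)) ++ map h1 w.
    by apply: (@Run_step A B T r (Some a) _ false) (IH false).
  by case: r.
split=> [[w Lw Tw]|[w Lw <-]]; last by exists w => //; apply: (run_head true).
exists w => //; suff: v = (if tr_init T then mark_head h0 h1 else map h1) w by [].
elim: Tw => {w v Lw} [[]//|r [a|] b r' w v [-> // _ ->] _ ->].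
by case: r.
Qed.

Lemma context_free_map (A B : finType) (h : A -> B) (L : set (seq A)) :
  context_free L -> context_free (map h @` L).
Proof.
move=> /(context_free_mark_head h h); apply: eq_context_free => v.
by split=> -[w Lw <-]; exists w; rewrite // map_mark_head.
Qed.

Lemma context_free_pmap (A B : finType) (h : A -> option B) (L : set (seq A)) :
  context_free L -> context_free (pmap h @` L).
Proof.
pose T := @Transducer A B unit tt (fun _ => True)
  (fun _ a b _ => isSome a /\ b = obind h a).
move=> /(context_free_transduce T); apply: eq_context_free => v.
split=> [[w Lw Tw]|[w Lw <-]]; exists w => //.
  elim: Tw => {w v Lw} [//|r [a|] b r' w v [// _ ->] _ <-] /=.
  by case: (h a).
elim: w {Lw} => [|a w IH]; first exact: Run_final.
have -> : pmap h (a :: w) = seq_of_opt (h a) ++ pmap h w by rewrite /=; case: (h a).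
exact: (@Run_step A B T tt (Some a) _ tt).
Qed.

(** The transducer copies its input while counting how many letters of [w0]
    it has matched; the count [size w0 + 1] records a mismatch. *)
Lemma context_free_filter_eq (A : finType) (w0 : seq A) (r : pred bool) (L : set (seq A)) :
  context_free L -> context_free [set w | L w /\ r (w == w0)].
Proof.
pose next (k : 'I_(size w0).+2) a : 'I_(size w0).+2 :=
  if (k < size w0)%N && (onth w0 k == Some a) then inord k.+1 else ord_max.
pose T := @Transducer A A 'I_(size w0).+2 ord0
  (fun k => r (k == size w0 :> nat))
  (fun k a b k' => exists c, [/\ a = Some c, b = Some c & k' = next k c]).
move=> /(context_free_transduce T); apply: eq_context_free => v.
have run_copy k w x : tr_run (T := T) k w x -> x = w /\ r (foldl next k w == size w0 :> nat).
  by elim=> {k w x} [k //|k a b k' w x [c [-> -> ->]] _ [-> ?]].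
have run_all k w : r (foldl next k w == size w0 :> nat) -> tr_run (T := T) k w w.
  elim: w k => [|a w IH] k; first by move=> rk; apply: Run_final.
  move=> /IH H; apply: (@Run_step A A T k (Some a) (Some a)) H.
  by exists a.
have foldE w k : (foldl next k w == size w0 :> nat) = (k <= size w0)%N && (w == drop k w0).
  elim: w k => [|a w IH] k /=.
    rewrite eqn_leq; case: leqP => //= kw.
    by rewrite -subn_eq0 -size_drop eq_sym; case: drop.
  rewrite IH /next; case: (ltnP k (size w0)) => /= kw; last first.
    rewrite /= ltnn /=; case: leqP => //= kw'.
    by rewrite drop_oversize.
  rewrite (ltnW kw) /= [in RHS](drop_nth a) // eqseq_cons onthE (nth_map a) //=.
  rewrite (inj_eq Some_inj) [a == _]eq_sym; case: (_ =P a) => _ /=; last by rewrite ltnn.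
  by rewrite inordK ?ltnS ?(ltnW kw) // kw.
have foldE0 w : (foldl next ord0 w == size w0 :> nat) = (w == w0) by rewrite foldE drop0.
split=> [[w Lw /run_copy[->]]|[Lv rv]]; first by rewrite foldE0.
by exists v => //; apply: run_all; rewrite foldE0.
Qed.

Lemma convolution_nil_l (T : Type) (v : seq T) :
  convolution [::] v = map (fun b => (None, Some b)) v.
Proof.
rewrite /convolution max0n; elim: v => //= b v IH.
rewrite /mkseq /= -IH /mkseq -[1%N]/(1 + 0)%N iotaDl -map_comp; congr cons.
by apply: eq_map => i /=; rewrite !onth0n.
Qed.

Lemma convolution_nil_r (T : Type) (u : seq T) :
  convolution u [::] = map (fun a => (Some a, None)) u.
Proof.
rewrite /convolution maxn0; elim: u => //= a u IH.
rewrite /mkseq /= -IH /mkseq -[1%N]/(1 + 0)%N iotaDl -map_comp; congr cons.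
by apply: eq_map => i /=; rewrite !onth0n.
Qed.

Lemma convolution_cons (T : Type) (a b : T) (u v : seq T) :
  convolution (a :: u) (b :: v) = (Some a, Some b) :: convolution u v.
Proof.
by rewrite /convolution /= maxnSS /mkseq /= -[1%N]/(1 + 0)%N iotaDl -map_comp.
Qed.

Section Tracks.
Variable T : Type.
Implicit Types (u v : seq T) (c : seq (option T * option T)).

(* In a word over pairs of optional letters, [None] may occur anywhere: the word
   aligns its two tracks in an arbitrary way, and [convolution] is the alignment
   whose padding comes last. *)
Definition track1 c := pmap fst c.
Definition track2 c := pmap snd c.
Definition gaps c := count (fun x => ~~ (isSome x.1 && isSome x.2)) c.

Lemma track1_cat c c' : track1 (c ++ c') = track1 c ++ track1 c'.
Proof. exact: pmap_cat. Qed.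

Lemma track2_cat c c' : track2 (c ++ c') = track2 c ++ track2 c'.
Proof. exact: pmap_cat. Qed.

Lemma gaps_cat c c' : gaps (c ++ c') = (gaps c + gaps c')%N.
Proof. exact: count_cat. Qed.

Lemma track1_convolution u v : track1 (convolution u v) = u.
Proof.
elim: u v => [|a u IH] [|b v] //.
- by rewrite convolution_nil_l; elim: (b :: v).
- by rewrite convolution_nil_r /=; congr cons; elim: u {IH} => //= x u ->.
- by rewrite convolution_cons /= IH.
Qed.

Lemma track2_convolution u v : track2 (convolution u v) = v.
Proof.
elim: v u => [|b v IH] [|a u] //.
- by rewrite convolution_nil_r; elim: (a :: u).
- by rewrite convolution_nil_l /=; congr cons; elim: v {IH} => //= x v ->.
- by rewrite convolution_cons /= IH.
Qed.

Lemma gaps_convolution u v : gaps (convolution u v) = (size u - size v + (size v - size u))%N.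
Proof.
elim: u v => [|a u IH] [|b v] //.
- by rewrite convolution_nil_l /gaps count_map count_predT.
- by rewrite convolution_nil_r /gaps count_map count_predT addn0.
- by rewrite convolution_cons /= IH !subSS.
Qed.

Lemma size_track1_le c : (size (track2 c) <= size (track1 c) + gaps c)%N.
Proof.
by elim: c => //= -[[a|] [b|]] c; rewrite /gaps /=; lia.
Qed.

Lemma size_track2_le c : (size (track1 c) <= size (track2 c) + gaps c)%N.
Proof.
by elim: c => //= -[[a|] [b|]] c; rewrite /gaps /=; lia.
Qed.

End Tracks.

Section Synchronization.
Variables (A : finType) (k : nat).
Local Notation pair_letter := (option A * option A)%type.

(** A state holds the letters of the two tracks that were read but not yet
    written; the Boolean tells that the input is exhausted, so that what is
    left of the longer track is written against the padding symbol. *)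
Inductive sync_step : bool -> seq A -> seq A -> option pair_letter ->
    option pair_letter -> bool -> seq A -> seq A -> Prop :=
| Sync_read b1 b2 o : sync_step false b1 b2 (Some o) None false
    (b1 ++ seq_of_opt o.1) (b2 ++ seq_of_opt o.2)
| Sync_write f a1 a2 b1 b2 : sync_step f (a1 :: b1) (a2 :: b2) None
    (Some (Some a1, Some a2)) f b1 b2
| Sync_tail1 f a b : sync_step f (a :: b) [::] None (Some (Some a, None)) true b [::]
| Sync_tail2 f a b : sync_step f [::] (a :: b) None (Some (None, Some a)) true [::] b.

Definition sync : transducer pair_letter pair_letter :=
  @Transducer _ _ (bool * (k.+1).-bseq A * (k.+1).-bseq A)%type (false, [bseq], [bseq])
    (fun r => r.1.2 = [::] :> seq A /\ r.2 = [::] :> seq A)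
    (fun r a b r' => sync_step r.1.1 r.1.2 r.2 a b r'.1.1 r'.1.2 r'.2).

Lemma sync_sound r c v : tr_run (T := sync) r c v ->
  (r.1.1 -> c = [::]) /\
  v = convolution (r.1.2 ++ track1 c) (r.2 ++ track2 c).
Proof.
elim=> {r c v} [[[f b1] b2] [/= -> ->]|r a b r' c v]; first by [].
move=> /= + _.
move: (r.1.1) (r.1.2 : seq A) (r.2 : seq A) (r'.1.1) (r'.1.2 : seq A) (r'.2 : seq A).
move=> f b1 b2 f' b1' b2'.
case=> {f b1 b2 a b f' b1' b2'} [b1 b2 [o1 o2]|f a1 a2 b1 b2|f a b|f a b] /= [cE ->].
- by split=> //; rewrite -!catA; case: o1 o2 {cE} => [x|] [y|].
- by split=> //; rewrite convolution_cons.
- by rewrite (cE isT) /= !cats0 !convolution_nil_r.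
- by rewrite (cE isT) /= !cats0 !convolution_nil_l.
Qed.

(** Each padding symbol still to come may lengthen the buffers by one letter, and
    a letter read on both tracks at once lengthens none for long; hence one extra
    cell besides the number of padding symbols suffices. *)
Lemma sync_complete c (b1 b2 : (k.+1).-bseq A) :
  nilp b1 || nilp b2 -> (size b1 + size b2 + gaps c <= k)%N ->
  tr_run (T := sync) (false, b1, b2) c (convolution (b1 ++ track1 c) (b2 ++ track2 c)).
Proof.
have tail1 f (b : seq A) (hb : (size b <= k.+1)%N) :
    tr_run (T := sync) (f, Bseq hb, [bseq]) [::] (convolution b [::]).
  elim: b f hb => [|a b IH] f hb; first exact: Run_final.
  rewrite convolution_nil_r /= -convolution_nil_r.
  apply: (@Run_step _ _ sync _ None (Some (Some a, None)) _ _ _ _ (IH true (ltnW hb))).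
  exact: Sync_tail1.
have tail2 f (b : seq A) (hb : (size b <= k.+1)%N) :
    tr_run (T := sync) (f, [bseq], Bseq hb) [::] (convolution [::] b).
  elim: b f hb => [|a b IH] f hb; first exact: Run_final.
  rewrite convolution_nil_l /= -convolution_nil_l.
  apply: (@Run_step _ _ sync _ None (Some (None, Some a)) _ _ _ _ (IH true (ltnW hb))).
  exact: Sync_tail2.
move: c b1 b2.
have write1 b1 b2 (h1 : (size b1 <= k.+1)%N) (h2 : (size b2 <= k.+1)%N) c :
    (forall (d1 d2 : (k.+1).-bseq A), nilp d1 || nilp d2 ->
       (size d1 + size d2 <= size b1 + size b2)%N ->
       (b1 != [::] -> b2 != [::] -> size d1 + size d2 + 2 <= size b1 + size b2)%N ->
       tr_run (T := sync) (false, d1, d2) c (convolution (d1 ++ track1 c) (d2 ++ track2 c))) ->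
    nilp b1 || nilp b2 || nilp (behead b1) || nilp (behead b2) ->
    tr_run (T := sync) (false, Bseq h1, Bseq h2) c (convolution (b1 ++ track1 c) (b2 ++ track2 c)).
  (* If both buffers are nonempty, a pair is written at once, which empties one. *)
  case: b1 h1 => [|a1 b1] h1; first by move=> H _; apply: (H (Bseq h1) (Bseq h2)).
  case: b2 h2 => [|a2 b2] h2 H nb; first by apply: (H (Bseq h1) (Bseq h2)); rewrite ?orbT.
  rewrite /= convolution_cons.
  have R : tr_run (T := sync) (false, Bseq (ltnW h1), Bseq (ltnW h2)) c
      (convolution (b1 ++ track1 c) (b2 ++ track2 c)).
    by apply: (H (Bseq (ltnW h1)) (Bseq (ltnW h2))) => //=; lia.
  apply: (@Run_step _ _ sync (false, Bseq h1, Bseq h2) None (Some (Some a1, Some a2)) _ _ _ _ R).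
  exact: Sync_write.
elim=> [|[o1 o2] c IH] b1 b2 nb hg.
  rewrite !cats0; case: b1 b2 nb hg => [[|x b1] h1] [[|y b2] h2] //= _ _.
  - rewrite (_ : Bseq h2 = [bseq]); last exact: val_inj.
    exact: (tail1 false _ h1).
  - rewrite (_ : Bseq h1 = [bseq]); last exact: val_inj.
    exact: (tail2 false _ h2).
  - rewrite (_ : Bseq h2 = [bseq]); last exact: val_inj.
    exact: (tail1 false _ h1).
have h1 : (size (b1 ++ seq_of_opt o1) <= k.+1)%N.
  by rewrite size_cat; case: (o1) hg => [a|] /=; lia.
have h2 : (size (b2 ++ seq_of_opt o2) <= k.+1)%N.
  by rewrite size_cat; case: (o2) hg => [a|] /=; lia.
have -> : convolution (b1 ++ track1 ((o1, o2) :: c)) (b2 ++ track2 ((o1, o2) :: c)) =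
    convolution ((b1 ++ seq_of_opt o1) ++ track1 c) ((b2 ++ seq_of_opt o2) ++ track2 c).
  by rewrite -!catA; case: (o1) (o2) => [?|] [?|].
apply: (@Run_step _ _ sync _ (Some (o1, o2)) None (false, Bseq h1, Bseq h2)).
  exact: Sync_read.
apply: write1 => [d1 d2 nd le1 le2|].
  apply: IH => //; move: hg le1 le2; rewrite /gaps /= !size_cat.
  case: (o1) (o2) => [a1|] [a2|] /= hg le1; try by move=> _; lia.
  have n1 : b1 ++ [:: a1] != [::] by case: (val b1).
  have n2 : b2 ++ [:: a2] != [::] by case: (val b2).
  by move=> /(_ n1 n2); lia.
case/orP: nb => /nilP ->; first by case: (o1) => [a|]; rewrite /nilp /= ?orbT.
by case: (o2) => [a|]; rewrite /nilp /= ?orbT.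
Qed.

End Synchronization.

(** If the padding symbols scattered in the words of [L] are bounded in number,
    a bounded buffer suffices to push them to the end. *)
Theorem context_free_convolution (A : finType) (k : nat)
    (L : set (seq (option A * option A))) :
  (forall c, L c -> (gaps c <= k)%N) -> context_free L ->
  context_free [set w | exists2 c, L c & w = convolution (track1 c) (track2 c)].
Proof.
move=> Lk /(context_free_transduce (sync A k)); apply: eq_context_free => w.
split=> [[c Lc /sync_sound[_ ->]]|[c Lc ->]]; exists c => //.
by apply: (@sync_complete A k c [bseq] [bseq]) => //=; apply: Lk.
Qed.

(** * Words and word length *)

Local Open Scope group_scope.

Section WordEval.
Variables (G : groupType) (I : finType) (g : I -> G).
Local Notation eval := (word_eval g).

Lemma word_eval_nil : eval [::] = 1.
Proof. by rewrite /word_eval big_nil. Qed.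

Lemma word_eval_cat w1 w2 : eval (w1 ++ w2) = eval w1 * eval w2.
Proof. exact: big_cat. Qed.

Lemma word_eval1 i b : eval [:: (i, b)] = if b then g i else (g i)^-1.
Proof. exact: big_seq1. Qed.

Lemma word_length_le w : (word_length g (eval w) <= size w)%N.
Proof.
rewrite /word_length; set P := (X in xget _ X).
by case: (xgetP 0%N P) => [k _ [_ /(_ w erefl)]|_ ].
Qed.

Lemma word_lengthP x : generates g ->
  exists2 w, eval w = x & size w = word_length g x.
Proof.
move=> /(_ x)[w0 w0x].
pose Q k := `[< exists2 w, eval w = x & size w = k >].
have exQ : exists k, Q k by exists (size w0); apply/asboolP; exists w0.
case: (ex_minnP exQ) => k /asboolP kP kmin.
rewrite /word_length; set P := (X in xget _ X).
suff Pk : P k by case: (xgetP 0%N P) => [? _ [[w ? ?] _]|/(_ k)//]; exists w.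
by split=> // w wx; apply/kmin/asboolP; exists w.
Qed.

Lemma word_eval_inv w : exists w', eval w' = (eval w)^-1.
Proof.
elim: w => [|[i b] w [w' IH]]; first by exists [::]; rewrite word_eval_nil invg1.
exists (w' ++ [:: (i, ~~ b)]); rewrite word_eval_cat word_eval1 IH.
rewrite -cat1s word_eval_cat word_eval1 invgM.
by case: b; rewrite ?invgK.
Qed.

End WordEval.

Section FreeWreath.
Variables (G : groupType) (n : nat).
Local Notation F := (free_group n).
Local Notation W := (wreath G F).
Implicit Types (x y : letter n) (b : F).

Definition fg_letter x : F := @FreeGroup n [:: x] isT.

Lemma fg_letterE x : fg_letter x = if x.2 then free_gen x.1 else (free_gen x.1)^-1.
Proof. by case: x => i []; apply: val_inj. Qed.

Lemma fg_letterV x : (fg_letter x)^-1 = fg_letter (letter_inv x).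
Proof. exact: val_inj. Qed.

Lemma fg_cat_rcons (s : seq (letter n)) x :
  reduced (rcons s x) -> fg_cat s [:: x] = rcons s x.
Proof. by move=> /fg_cats0 <-; rewrite /fg_cat foldr_rcons. Qed.

Lemma wr_mulE (u v : W) b : wr_fun (u * v) b = wr_fun u b * wr_fun v ((wr_pos u)^-1 * b).
Proof. by rewrite /= fs_mulE fs_actE. Qed.

Lemma wr_posM (u v : W) : wr_pos (u * v) = wr_pos u * wr_pos v.
Proof. by []. Qed.

Lemma wr_fun1 b : wr_fun (1 : W) b = 1.
Proof. by rewrite /= fsfunE. Qed.

Lemma wr_shiftM b c : wr_shift G (b * c) = wr_shift G b * wr_shift G c :> W.
Proof.
by apply: wr_eq => // a; rewrite wr_mulE /= !fsfunE mul1g.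
Qed.

Lemma wr_shift1 : wr_shift G 1 = 1 :> W.
Proof. by []. Qed.

Lemma wr_shiftV b : (wr_shift G b)^-1 = wr_shift G b^-1 :> W.
Proof. by apply: (mulgI (wr_shift G b)); rewrite mulgV -wr_shiftM mulgV. Qed.

Lemma wr_lampM (c d : G) : wr_lamp F (c * d) = wr_lamp F c * wr_lamp F d.
Proof.
apply: wr_eq => [a|] /=; last by rewrite mul1g.
rewrite fs_mulE fs_actE !fs_singleE invg1 mul1g.
by case: ifP => //; rewrite mul1g.
Qed.

Lemma wr_lamp1 : wr_lamp F 1 = 1 :> W.
Proof. by apply: wr_eq => //= a; rewrite fs_singleE fsfunE if_same. Qed.

Lemma wr_lampV (c : G) : (wr_lamp F c)^-1 = wr_lamp F c^-1.
Proof. by apply: (mulgI (wr_lamp F c)); rewrite mulgV -wr_lampM mulgV wr_lamp1. Qed.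

Variables (m : nat) (g : 'I_m -> G).
Local Notation S := (@wreath_gens G m n g).
Local Notation lift_lamps w := [seq (inl i.1 : 'I_m + 'I_n, i.2) | i <- w].
Local Notation letter_word x := [:: (inr x.1 : 'I_m + 'I_n, x.2)].

Lemma word_eval_lamps (w : seq ('I_m * bool)) :
  word_eval S (lift_lamps w) = wr_lamp F (word_eval g w).
Proof.
elim: w => [|[i b] w IH]; first by rewrite /= !word_eval_nil wr_lamp1.
rewrite /= -cat1s word_eval_cat IH word_eval1 -[(i, b) :: w]cat1s.
rewrite word_eval_cat word_eval1 wr_lampM.
by case: b; rewrite ?wr_lampV.
Qed.

Lemma word_eval_letter x : word_eval S (letter_word x) = wr_shift G (fg_letter x).
Proof. by rewrite word_eval1 fg_letterE; case: x.2; rewrite /= ?wr_shiftV. Qed.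

(** Induction on the size of the support: a conjugate of a lamp by a shift
    switches off one point of the support, and an element with empty support is
    a shift. *)
Lemma wreath_generates : generates g -> generates S.
Proof.
move=> gen_g; pose P (z : W) := exists w, word_eval S w = z.
have PM (z t : W) : P z -> P t -> P (z * t).
  by move=> [w <-] [w' <-]; exists (w ++ w'); rewrite word_eval_cat.
have PV (z : W) : P z -> P z^-1.
  by move=> [w <-]; have [w'] := word_eval_inv S w; exists w'.
have P1 : P 1 by exists [::]; rewrite word_eval_nil.
have Plamp c : P (wr_lamp F c).
  by have [w <-] := gen_g c; exists (lift_lamps w); apply: word_eval_lamps.
have Pshift b : P (wr_shift G b).
  case: b => s; elim: s => [|x s IH] rs.
    by rewrite (_ : FreeGroup rs = 1); [rewrite wr_shift1|apply: val_inj].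
  rewrite (_ : FreeGroup rs = fg_letter x * FreeGroup (reduced_behead rs)).
    rewrite wr_shiftM; apply: PM; last exact: IH.
    by exists (letter_word x); rewrite word_eval_letter.
  apply: val_inj => /=; case: s rs {IH} => //= y s /andP[/negPf -> _] //.
move=> z; rewrite -/(P z).
have [k] := ubnP #|` finsupp (wr_fun z)|%fset.
elim: k => // k IH in z *.
case: (fset_0Vmem (finsupp (wr_fun z))) => [f0 _|[b bf] le_k].
  suff -> : z = wr_shift G (wr_pos z) by [].
  apply: wr_eq => //= b; rewrite fsfunE /=.
  by apply: fsfun_dflt; rewrite f0.
pose l := wr_shift G b * wr_lamp F (wr_fun z b)^-1 * wr_shift G b^-1.
have lE c : wr_fun l c = if c == b then (wr_fun z b)^-1 else 1.
  rewrite /l !wr_mulE /= !fsfunE mul1g mulg1 in_fset1.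
  by rewrite -(inj_eq (mulgI b)) mulVKg mulg1.
have l1 : wr_pos l = 1 by rewrite /l !wr_posM /= mulg1 mulgV.
rewrite -[z](mulKg l); apply: (PM); first exact: (PV _ (PM _ _ (PM _ _ (Pshift b) (Plamp _)) (Pshift _))).
apply: IH; rewrite ltnS in le_k; apply: leq_trans le_k.
apply: leq_ltn_trans (fproper_ltn_card (fproperD1 bf)).
apply/fsubset_leq_card/fsubsetP => c.
rewrite in_fsetD1 !mem_finsupp wr_mulE lE l1 invg1 mul1g.
by case: (c =P b) => [->|_]; rewrite ?mulVg ?mul1g ?eqxx.
Qed.

End FreeWreath.

(** * Labelled forests and their codes *)

(** A forest of vertices of the Cayley tree of the free group. A vertex is
    reached from its parent along the direction [d], the root along [None];
    [marked] tells whether it is the current position and [u] represents the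
    value of the function there. The last two arguments are the forest of its
    children and the forest of its later siblings. *)
Inductive forest (n : nat) (A : Type) : Type :=
| Void
| Vertex (d : option (letter n)) (marked : bool) (u : seq A)
       (children siblings : forest n A).
Arguments Void {n A}.

Section Forests.
Variables (n : nat) (A : finType).
Notation dir := (option (letter n)).
Notation flag := (dir * bool * bool * bool)%type.
Notation symbol := (option flag * A)%type.
Local Notation forest := (forest n A).
Implicit Types (t c s : forest) (d : dir) (m : bool) (u : seq A) (p : seq dir).

Definition nonnil t := if t is Void then false else true.

(** No brackets are needed: the first letter of each label tells whether the
    vertex has children and later siblings. Hence a vertex costs exactly the
    length of its label. *)
Definition flagged (fl : flag) u : seq symbol :=
  mark_head (fun a => (Some fl, a)) (fun a => (None, a)) u.

Fixpoint enc t : seq symbol :=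
  if t is Vertex d m u c s
  then flagged (d, m, nonnil c, nonnil s) u ++ enc c ++ enc s else [::].

Lemma size_flagged fl u : size (flagged fl u) = size u.
Proof. by case: u => //= a u; rewrite size_map. Qed.

(** The children of a vertex entered along [d] lie in all directions but the
    way back; siblings come in the order of [enum_rank]. *)
Definition child_dirs d : {set dir} :=
  [set y | if y is Some x then d != Some (letter_inv x) else false].

Definition later_dirs d (X : {set dir}) : {set dir} :=
  [set y in X | (enum_rank d < enum_rank y)%N].

Fixpoint marks t : nat :=
  if t is Vertex _ m _ c s then (m + marks c + marks s)%N else 0%N.

Fixpoint marked_at t p : bool :=
  match t, p with
  | Vertex d m u c s, e :: p' =>
      if e == d then (if p' is [::] then m else marked_at c p') else marked_at s p
  | _, _ => false
  end.

Fixpoint in_tree (X : {set dir}) p : bool :=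
  if p is d :: p' then (d \in X) && ((p' == [::]) || in_tree (child_dirs d) p') else false.

Lemma in_tree_later d X p : in_tree (later_dirs d X) p -> in_tree X p.
Proof. by case: p => //= e p; rewrite inE -andbA => /and3P[-> _ ->]. Qed.

Lemma in_tree_later_head d X p : in_tree (later_dirs d X) p -> ohead p != Some d.
Proof.
case: p => //= e p; rewrite inE -andbA => /and3P[_ + _].
by apply: contraTneq => -[->]; rewrite ltnn.
Qed.

Section Valid.
Variables (L : set (seq A)) (u1 : seq A).

(** Leaves that carry the unit [u1] and are not the current position are
    excluded, so the tree is the smallest one that contains the support, the
    position and the root. *)
Fixpoint valid (X : {set dir}) t : Prop :=
  if t is Vertex d m u c s then
    [/\ d \in X, L u, [|| m, nonnil c | u != u1],
        valid (child_dirs d) c & valid (later_dirs d X) s]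
  else True.

Hypothesis L_nil : ~ L [::].

Lemma flagged_cons fl u : L u -> exists a u', u = a :: u' /\
  flagged fl u = (Some fl, a) :: map (fun a => (None, a)) u'.
Proof. by case: u => // a u _; exists a, u. Qed.

Definition starts_flagged (r : seq symbol) := if r is x :: _ then isSome x.1 else true.

Lemma flagged_prefix fl fl' u u' r r' : L u -> L u' ->
  starts_flagged r -> starts_flagged r' ->
  flagged fl u ++ r = flagged fl' u' ++ r' -> [/\ fl = fl', u = u' & r = r'].
Proof.
move=> /(flagged_cons fl)[a [v [-> ->]]] /(flagged_cons fl')[a' [v' [-> ->]]] sr sr' /=.
move=> [-> -> E]; suff [-> ->] : v = v' /\ r = r' by [].
elim: v v' E => [|x v IH] [|x' v'] //= E.
- by move: sr; rewrite E.
- by move: sr'; rewrite -E.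
- by case: E => -> /IH[-> ->].
Qed.

Lemma starts_flagged_enc X t r : valid X t -> starts_flagged r -> starts_flagged (enc t ++ r).
Proof. by case: t => //= d m u c s [_ /(flagged_cons (d, m, nonnil c, nonnil s))[a [u' [_ ->]]]]. Qed.

(** The flags make the code of a forest prefix-free up to a flagged letter. *)
Lemma enc_prefix X X' t t' r r' : valid X t -> valid X' t' ->
  starts_flagged r -> starts_flagged r' -> nonnil t = nonnil t' ->
  enc t ++ r = enc t' ++ r' -> t = t' /\ r = r'.
Proof.
elim: t X X' t' r r' => [|d m u c IHc s IHs] X X' [|d' m' u' c' s'] r r' //=.
move=> [_ Lu _ vc vs] [_ Lu' _ vc' vs'] sr sr' _; rewrite -!catA => /flagged_prefix[] //.
- exact: starts_flagged_enc vc (starts_flagged_enc vs sr).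
- exact: starts_flagged_enc vc' (starts_flagged_enc vs' sr').
move=> [-> -> nc ns] -> E.
have [] := IHc _ _ _ _ _ vc vc' _ _ nc E.
- exact: starts_flagged_enc vs sr.
- exact: starts_flagged_enc vs' sr'.
by move=> -> /(IHs _ _ _ _ _ vs vs' sr sr' ns)[-> ->].
Qed.

Lemma enc_inj X X' t t' : valid X t -> valid X' t' -> enc t = enc t' -> t = t'.
Proof.
move=> v v' E; have [] // := enc_prefix (r := [::]) (r' := [::]) v v'; last by rewrite E.
case: t t' v v' E => [|d m u c s] [|d' m' u' c' s'] //=.
- by move=> _ [_ /(flagged_cons (d', m', nonnil c', nonnil s'))[a [u1' [_ ->]]]].
- by move=> [_ /(flagged_cons (d, m, nonnil c, nonnil s))[a [u1' [_ ->]]]].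
Qed.

Lemma marked_at_in_tree X t p : valid X t -> marked_at t p -> in_tree X p.
Proof.
elim: t X p => [|d m u c IHc s IHs] X [|e p] //= [dX _ _ vc vs].
case: eqP => [->|_]; last by move=> /(IHs _ (_ :: _) vs)/in_tree_later.
by rewrite dX; case: p => //= e' p /(IHc _ _ vc).
Qed.

Variables (G : groupType) (psi : seq A -> G).

Fixpoint value_at t p : G :=
  match t, p with
  | Vertex d m u c s, e :: p' =>
      if e == d then (if p' is [::] then psi u else value_at c p') else value_at s p
  | _, _ => 1
  end.

Lemma value_at_in_tree X t p : valid X t -> value_at t p != 1 -> in_tree X p.
Proof.
elim: t X p => [|d m u c IHc s IHs] X [|e p] //=; rewrite ?eqxx //.
move=> [dX _ _ vc vs].
case: (e =P d) => [->|_]; last by move=> /(IHs _ (_ :: _) vs)/in_tree_later.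
by rewrite dX; case: p => //= e' p /(IHc _ _ vc).
Qed.

Hypotheses (Lu1 : L u1) (psi_u1 : psi u1 = 1).
Hypothesis psi_inj : forall u v, L u -> L v -> psi u = psi v -> u = v.

Lemma valid_nontrivial X d m u c s : valid X (Vertex d m u c s) ->
  exists p, marked_at (Vertex d m u c s) (d :: p) || (value_at (Vertex d m u c s) (d :: p) != 1).
Proof.
elim: c X d m u s => [|d' m' u' c' IHc s' _] X d m u s /=.
  move=> [_ Lu /orP[->|nu] _ _]; first by exists [::]; rewrite eqxx.
  exists [::]; rewrite eqxx; apply/orP; right; apply: contraNneq nu.
  by rewrite -psi_u1 => /psi_inj -> .
move=> [_ Lu _ vc _]; have [p Hp] := IHc _ _ _ _ _ vc.
by exists (d' :: p); move: Hp; rewrite /= !eqxx.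
Qed.

Lemma later_dirs_total d d' (X : {set dir}) : d \in X -> d' \in X -> d != d' ->
  (d' \in later_dirs d X) || (d \in later_dirs d' X).
Proof.
move=> dX dX' nd; rewrite !inE dX dX' /= -neq_ltn.
by apply: contraNneq nd => /val_inj/enum_rank_inj ->.
Qed.

Lemma valid_in_later d d' (X : {set dir}) p t : valid (later_dirs d X) t -> d \in later_dirs d' X ->
  marked_at t (d' :: p) || (value_at t (d' :: p) != 1) -> False.
Proof.
move=> vt; rewrite !inE => /andP[_ d'd] /orP[/(marked_at_in_tree vt)|/(value_at_in_tree vt)] /=;
  by rewrite inE -andbA => /and3P[_ dd' _]; move: (ltn_trans d'd dd'); rewrite ltnn.
Qed.

(** In a valid forest the subtree in a direction is absent exactly when it would
    carry neither a mark nor a value other than 1, so that even the shape can be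
    read off from the marks and values. *)
Lemma valid_ext X t t' : valid X t -> valid X t' ->
  marked_at t =1 marked_at t' -> value_at t =1 value_at t' -> t = t'.
Proof.
elim: t X t' => [|d m u c IHc s IHs] X [|d' m' u' c' s'] vt vt' Em Ev //.
- by have [p] := valid_nontrivial vt'; rewrite -Em -Ev eqxx.
- by have [p] := valid_nontrivial vt; rewrite Em Ev eqxx.
have dd' : d = d'.
  have [//|nd] := eqVneq d d'.
  have [[dX _ _ _ vs] [dX' _ _ _ vs']] := (vt, vt').
  have /orP[d1|d1] := later_dirs_total dX dX' nd.
  - have [p] := valid_nontrivial vt; rewrite Em Ev /= (negPf nd).
    by move=> /(valid_in_later vs' d1).
  - have [p] := valid_nontrivial vt'; rewrite -Em -Ev /=.
    by rewrite eq_sym (negPf nd) => /(valid_in_later vs d1).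
subst d'; have [[dX Lu _ vc vs] [_ Lu' _ vc' vs']] := (vt, vt').
have -> : m = m' by have := Em [:: d]; rewrite /= eqxx.
have -> : u = u' by apply: psi_inj => //; have := Ev [:: d]; rewrite /= eqxx.
congr Vertex.
  apply: (IHc _ _ vc vc') => -[|e p].
  - by case: (c) (c') => [|? ? ? ? ?] [].
  - by have := Em [:: d, e & p]; rewrite /= eqxx.
  - by case: (c) (c') => [|? ? ? ? ?] [].
  - by have := Ev [:: d, e & p]; rewrite /= eqxx.
apply: (IHs _ _ vs vs') => -[|e p].
- by case: (s) (s') => [|? ? ? ? ?] [].
- case: (e =P d) => [->|/eqP/negPf ed]; last by have := Em (e :: p); rewrite /= ed.
  have out t0 : valid (later_dirs d X) t0 -> marked_at t0 (d :: p) = false.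
    move=> v0; apply/negP => /(marked_at_in_tree v0)/in_tree_later_head.
    by rewrite eqxx.
  by rewrite !out.
- by case: (s) (s') => [|? ? ? ? ?] [].
- case: (e =P d) => [->|/eqP/negPf ed]; last by have := Ev (e :: p); rewrite /= ed.
  have out t0 : valid (later_dirs d X) t0 -> value_at t0 (d :: p) = 1.
    move=> v0; apply/eqP/negPn/negP => /(value_at_in_tree v0)/in_tree_later_head.
    by rewrite eqxx.
  by rewrite !out.
Qed.

End Valid.
End Forests.

(** * Forests as elements of the wreath product *)

Section TreePaths.
Variable n : nat.
Local Notation F := (free_group n).
Local Notation dir := (option (letter n)).
Implicit Types (y : letter n) (s : seq (letter n)) (p : seq dir) (b : F).

Definition dirs_of (s : seq (letter n)) : seq dir := map Some s.
Definition tree_path b : seq dir := None :: dirs_of (fg_word b).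
Definition root_dirs : {set dir} := [set None].

Lemma in_tree_letters d p : in_tree (child_dirs d) p -> exists s, p = dirs_of s.
Proof.
elim: p d => //= -[y|] p IH d; last by rewrite inE.
case/andP=> _ /orP[/eqP->|/IH[s ->]]; first by exists [:: y].
by exists (y :: s).
Qed.

Lemma letter_inv_eq (x y : letter n) : (x == letter_inv y) = (y == letter_inv x).
Proof. by rewrite eq_sym (inv_eq (@letter_invK n)). Qed.

Lemma reduced_in_tree y s :
  reduced (y :: s) = (s == [::]) || in_tree (child_dirs (Some y)) (dirs_of s).
Proof.
rewrite /reduced; elim: s y => [|x s IH] y //=.
move: (IH x) => /= ->; rewrite inE /= letter_inv_eq; congr (_ && _).
by case: s {IH}.
Qed.

Lemma reduced_in_root_tree s :
  reduced s = (s == [::]) || in_tree (child_dirs None) (dirs_of s).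
Proof.
by case: s => [|y s] //; rewrite reduced_in_tree /= inE; case: s.
Qed.

Lemma in_root_treeP p : reflect (exists b, p = tree_path b) (in_tree root_dirs p).
Proof.
apply: (iffP idP) => [|[[s rs] ->]] /=; last first.
  rewrite inE eqxx /=; move: rs; rewrite reduced_in_root_tree.
  by case: s.
case: p => //= d p; rewrite inE => /andP[/eqP-> pP].
have [s ps] : exists s, p = dirs_of s.
  by case/orP: pP => [/eqP->|/in_tree_letters //]; exists [::].
have rs : reduced s.
  by rewrite reduced_in_root_tree; move: pP; rewrite ps; case: (s).
by exists (FreeGroup rs); rewrite /tree_path ps.
Qed.

Lemma tree_path_inj : injective tree_path.
Proof. by move=> b c [/(inj_map Some_inj) ?]; apply: val_inj. Qed.

(** Seen from the neighbour [y] of the unit, a point either lies behind [y],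
    or its reduced word gets longer. *)
Variant left_letter_spec y b : F -> Prop :=
| Left_behind b' of fg_word b = y :: fg_word b' : left_letter_spec y b b'
| Left_away b' of ohead b != Some y & fg_word b' = letter_inv y :: fg_word b :
    left_letter_spec y b b'.

Lemma left_letterP y b : left_letter_spec y b ((fg_letter y)^-1 * b).
Proof.
have E : fg_word ((fg_letter y)^-1 * b) = fg_push (letter_inv y) (fg_word b) by [].
move: (_ * b) E => b'; case: b => -[|x s] rs /= E; first exact: Left_away.
rewrite letter_invK in E; have [xy|nxy] := eqVneq x y.
  by apply: Left_behind; rewrite E /= xy eqxx.
apply: Left_away => /=; first by rewrite (inj_eq Some_inj).
by rewrite E (negPf nxy).
Qed.

End TreePaths.

Section Denotation.
Variables (n : nat) (A : finType) (L : set (seq A)) (u1 : seq A).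
Variables (G : groupType) (psi : seq A -> G).
Hypotheses (L_nil : ~ L [::]) (Lu1 : L u1) (psi_u1 : psi u1 = 1).
Hypothesis psi_inj : forall u v, L u -> L v -> psi u = psi v -> u = v.
Local Notation F := (free_group n).
Local Notation W := (wreath G F).
Local Notation forest := (forest n A).
Local Notation valid := (valid L u1).
Local Notation value_at := (value_at psi).
Implicit Types (t c s : forest) (x : W) (b : F) (y : letter n).

Definition denotes t x : Prop :=
  (forall b, marked_at t (tree_path b) = (b == wr_pos x)) /\
  (forall b, value_at t (tree_path b) = wr_fun x b).

Lemma denotes_unique t x x' : denotes t x -> denotes t x' -> x = x'.
Proof.
move=> [mx vx] [mx' vx']; apply: wr_eq => [b|]; first by rewrite -vx -vx'.
by apply/eqP; rewrite -mx' mx.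
Qed.

(** Paths that are not reduced words carry no mark and the value 1 in any valid
    tree, so agreement on the group is agreement everywhere. *)
Lemma denotes_inj t t' x : valid (root_dirs n) t -> valid (root_dirs n) t' ->
  denotes t x -> denotes t' x -> t = t'.
Proof.
move=> vt vt' [mx vx] [mx' vx'].
apply: (valid_ext Lu1 psi_u1 psi_inj vt vt') => p.
- have [/in_root_treeP[b ->]|np] := boolP (in_tree (root_dirs n) p).
    by rewrite mx mx'.
  have out t0 : valid (root_dirs n) t0 -> marked_at t0 p = false.
    by move=> v0; apply: contraNF np; apply: marked_at_in_tree v0.
  by rewrite !out.
- have [/in_root_treeP[b ->]|np] := boolP (in_tree (root_dirs n) p).
    by rewrite vx vx'.
  have out t0 : valid (root_dirs n) t0 -> value_at t0 p = 1.
    by move=> v0; apply/eqP; apply: contraNT np; apply: value_at_in_tree v0.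
  by rewrite !out.
Qed.

Lemma marks0_marked_at t p : marks t = 0%N -> marked_at t p = false.
Proof.
elim: t p => //= d m u c IHc s IHs [|e p] // /eqP.
rewrite !addn_eq0 => /andP[/andP[/eqP m0 /eqP c0] /eqP s0].
case: eqP => _; last exact: IHs.
by case: p => [|e' p]; [case: m m0 | apply: IHc].
Qed.

Section Tours.
Variables (m : nat) (g : 'I_m -> G).
Hypothesis gen_g : generates g.
Local Notation S := (@wreath_gens G m n g).
Local Notation eval := (word_eval S).

(** Each vertex is paid for by its value and by the two crossings of the edge
    to its parent. *)
Fixpoint tour_cost t : nat :=
  if t is Vertex _ _ u c s
  then (word_length g (psi u) + 2 + tour_cost c + tour_cost s)%N else 0%N.

(** [writes] and [stands] read a forest as the part of the tree below the unit:
    its paths are reduced words, with no initial [None]. *)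
Definition writes t x : Prop :=
  forall b, wr_fun x b = value_at t (dirs_of (fg_word b)).

Definition stands t x : Prop :=
  forall b, marked_at t (dirs_of (fg_word b)) = (b == wr_pos x).

(** Going along [y], setting the value there and touring the children changes the
    function exactly on the words that begin with [y]: the children avoid the
    inverse of [y], so left translation by [y] causes no cancellation. *)
Lemma visit_vertex y mk u c s x b : valid (child_dirs (Some y)) c -> writes c x ->
  wr_fun (wr_shift G (fg_letter y) * wr_lamp F (psi u) * x) b =
  if ohead b == Some y then value_at (Vertex (Some y) mk u c s) (dirs_of (fg_word b)) else 1.
Proof.
move=> vc cx; rewrite !wr_mulE /= !fsfunE mul1g mulg1 in_fset1 cx.
case: left_letterP => [b' bE|b' nb b'E].
  rewrite bE /= eqxx /=.
  have -> : (b' == 1) = (fg_word b' == [::]) by [].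
  case: (fg_word b') => [|x' s'] /=; last by rewrite mul1g.
  by case: (c) => [|? ? ? ? ?]; rewrite mulg1.
rewrite (negPf nb).
have -> : (b' == 1) = (fg_word b' == [::]) by [].
rewrite b'E /= mul1g; apply/eqP; apply: contraT => /(value_at_in_tree vc) /=.
by rewrite inE /= letter_invK eqxx.
Qed.

Lemma lamp_word u : exists2 w, eval w = wr_lamp F (psi u) & size w = word_length g (psi u).
Proof.
have [w wE <-] := word_lengthP (psi u) gen_g.
by exists [seq (inl i.1 : 'I_m + 'I_n, i.2) | i <- w]; rewrite ?size_map // word_eval_lamps wE.
Qed.

Lemma letter_word y : exists2 w, eval w = wr_shift G (fg_letter y) & size w = 1%N.
Proof. by exists [:: (inr y.1 : 'I_m + 'I_n, y.2)]; rewrite ?word_eval_letter. Qed.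

Lemma letter_word_inv y : exists2 w, eval w = wr_shift G (fg_letter y)^-1 & size w = 1%N.
Proof. by rewrite fg_letterV; apply: letter_word. Qed.

(** A branch and the later branches have disjoint supports, so their contributions
    commute. This permits the tours below to visit them in either order. *)
Lemma value_at_split (X : {set option (letter n)}) y mk u c s b :
  valid (later_dirs (Some y) X) s ->
  let v := value_at (Vertex (Some y) mk u c s) (dirs_of (fg_word b)) in
  let v1 := if ohead b == Some y then v else 1 in
  let v2 := value_at s (dirs_of (fg_word b)) in
  v1 * v2 = v /\ v2 * v1 = v.
Proof.
move=> vs; case: b => -[|x w] rw /=.
  by case: (s) => [|? ? ? ? ?]; rewrite mulg1.
rewrite (inj_eq Some_inj); case: (x =P y) => [->|_]; last by rewrite mul1g mulg1.
suff -> : value_at s (Some y :: dirs_of w) = 1 by rewrite mulg1 mul1g.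
apply/eqP; apply: contraT => /(value_at_in_tree vs)/in_tree_later_head.
by rewrite eqxx.
Qed.

Lemma tour_return (X : {set option (letter n)}) t : valid X t -> None \notin X -> exists w,
  [/\ (size w <= tour_cost t)%N, wr_pos (eval w) = 1 & writes t (eval w)].
Proof.
elim: t X => [|d mk u c IHc s IHs] X.
  by move=> _ _; exists [::]; rewrite word_eval_nil; split=> // b; rewrite wr_fun1.
move=> /= [dX Lu _ vc vs] nX; case: d dX vc vs => [y|] dX vc vs; last by rewrite dX in nX.
have [|wc [sc pc fc]] := IHc _ vc; first by rewrite inE.
have [|ws [ss ps fs]] := IHs _ vs; first by rewrite inE (negPf nX).
have [wu uE su] := lamp_word u.
have [wy yE sy] := letter_word y; have [wz zE sz] := letter_word_inv y.
exists (((wy ++ wu) ++ wc) ++ wz ++ ws); split.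
- by rewrite !size_cat su sy sz; move: sc ss => /=; lia.
- by rewrite !word_eval_cat !wr_posM pc ps yE uE zE /= !mulg1 mulgV.
move=> b; rewrite !word_eval_cat yE uE zE wr_mulE (visit_vertex mk u s _ vc fc).
rewrite !wr_posM pc [wr_pos _]/= [wr_pos (wr_lamp _ _)]/= !mulg1 wr_mulE.
rewrite [wr_fun (wr_shift _ _) _]fsfunE mul1g [wr_pos _]/= invgK mulVKg fs.
exact: (value_at_split mk u c b vs).1.
Qed.

(** The subtree with the current position is visited last, so that the way back
    from it is saved. *)
Lemma tour_stand (X : {set option (letter n)}) t : valid X t -> None \notin X -> marks t = 1%N ->
  exists w, [/\ (size w <= tour_cost t)%N, stands t (eval w) & writes t (eval w)].
Proof.
elim: t X => [|d mk u c IHc s IHs] X //.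
move=> /= [dX Lu _ vc vs] nX; case: d dX vc vs => [y|] dX vc vs; last by rewrite dX in nX.
have nc : None \notin child_dirs (Some y) by rewrite inE.
have ns : None \notin later_dirs (Some y) X by rewrite inE (negPf nX).
have [wc [sc pc fc]] := tour_return vc nc.
have [ws [ss ps fs]] := tour_return vs ns.
have [wu uE su] := lamp_word u.
have [wy yE sy] := letter_word y; have [wz zE sz] := letter_word_inv y.
case: mk => [mk1|]; last rewrite add0n.
  have [mc ms] : marks c = 0%N /\ marks s = 0%N by lia.
  exists (ws ++ ((wy ++ wu) ++ wc)); split=> [|b|b].
  - by rewrite !size_cat su sy; move: sc ss => /=; lia.
  - rewrite !word_eval_cat !wr_posM ps pc yE uE /= !mulg1 mul1g.
    rewrite -val_eqE /=.
    case: (fg_word b) => [|x [|x' w]] //=; rewrite !marks0_marked_at ?if_same //.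
    by rewrite eqseq_cons andbF.
  - rewrite !word_eval_cat yE uE wr_mulE ps invg1 mul1g (visit_vertex true u s _ vc fc) fs.
    exact: (value_at_split true u c b vs).2.
case mc: (marks c) => [|k] mk1; last first.
  have [mc1 ms] : marks c = 1%N /\ marks s = 0%N by lia.
  have [wc' [sc' pc' fc']] := IHc _ vc nc mc1.
  exists (ws ++ ((wy ++ wu) ++ wc')); split=> [|b|b].
  - by rewrite !size_cat su sy; move: sc' ss => /=; lia.
  - rewrite !word_eval_cat !wr_posM ps yE uE /= !mulg1 mul1g.
    rewrite -(inj_eq (mulgI (fg_letter y)^-1)) mulKg.
    case: left_letterP => [b' bE|b' nb b'E]; rewrite -pc'.
      by rewrite bE /= eqxx; case: (fg_word b') => //; case: (c) => [|? ? ? ? ?].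
    rewrite b'E (marks0_marked_at _ ms).
    have -> : marked_at c (dirs_of (letter_inv y :: fg_word b)) = false.
      apply: contraTF isT => /(marked_at_in_tree vc) /=.
      by rewrite inE /= letter_invK eqxx.
    case: (fg_word b) nb => //= x w; rewrite (inj_eq Some_inj) => /negPf ->.
    done.
  - rewrite !word_eval_cat yE uE wr_mulE ps invg1 mul1g (visit_vertex false u s _ vc fc') fs.
    exact: (value_at_split false u c b vs).2.
have [ws' [ss' ps' fs']] := IHs _ vs ns mk1.
exists (((wy ++ wu) ++ wc) ++ wz ++ ws'); split=> [|b|b].
- by rewrite !size_cat su sy sz; move: sc ss' => /=; lia.
- rewrite !word_eval_cat !wr_posM pc yE uE zE /= !mulg1 mulVKg -ps'.
  case: (fg_word b) => [|x w] /=; first by case: (s).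
  rewrite (inj_eq Some_inj); case: (x =P y) => [->|//].
  transitivity false; first by case: (dirs_of w) => // *; rewrite marks0_marked_at.
  apply/esym; apply: contraTF isT => /(marked_at_in_tree vs)/in_tree_later_head.
  by rewrite eqxx.
- rewrite !word_eval_cat yE uE zE wr_mulE (visit_vertex false u s _ vc fc).
  rewrite !wr_posM pc [wr_pos _]/= [wr_pos (wr_lamp _ _)]/= !mulg1 wr_mulE.
  rewrite [wr_fun (wr_shift _ _) _]fsfunE mul1g [wr_pos _]/= invgK mulVKg fs'.
  exact: (value_at_split false u c b vs).1.
Qed.

(** The root is entered from nowhere, which saves its two edge crossings. *)
Lemma tour_root t : valid (root_dirs n) t -> marks t = 1%N ->
  exists2 w, (size w + 2 <= tour_cost t)%N & denotes t (eval w).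
Proof.
case: t => [//|d mk u c s] /= [+ Lu _ vc vs]; rewrite inE => /eqP dE; subst d.
have s0 : s = Void.
  case: s vs => // d' ? ? ? ? [+ _ _ _ _]; rewrite !inE => /andP[/eqP->].
  by rewrite ltnn.
subst s; rewrite /= addn0 => mk1.
have nc : None \notin child_dirs (n := n) None by rewrite inE.
have [wu uE su] := lamp_word u.
have values wc : writes c (eval wc) -> forall b,
    value_at (Vertex None mk u c Void) (tree_path b) = wr_fun (eval (wu ++ wc)) b.
  move=> fc b; rewrite word_eval_cat uE wr_mulE [wr_pos _]/= invg1 mul1g fc [wr_fun _ _]fs_singleE.
  rewrite /tree_path /= -val_eqE /=.
  case: (fg_word b) => [|x w] /=; last by rewrite mul1g.
  by case: (c) => [|? ? ? ? ?]; rewrite mulg1.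
case: mk mk1 values => [mk1|] values.
  have mc : marks c = 0%N by lia.
  have [wc [sc pc fc]] := tour_return vc nc.
  exists (wu ++ wc); first by rewrite size_cat su; move: sc => /=; lia.
  split=> b; last exact: values.
  rewrite word_eval_cat uE wr_posM pc /= mulg1 -val_eqE /= marks0_marked_at //.
  by case: (fg_word b).
move=> values'; have [wc [sc pc fc]] := tour_stand vc nc values.
exists (wu ++ wc); first by rewrite size_cat su; move: sc => /=; lia.
split=> b; last exact: values'.
rewrite word_eval_cat uE wr_posM /= mul1g -pc.
by case: (fg_word b) => //; case: (c).
Qed.

End Tours.
End Denotation.

(** * Multiplication by a generator as an edit of forests *)

(** What remains to be done to a forest: nothing, the whole edit, or the arrival
    of the position. The Booleans tell whether the forest is nonempty before. *)
Inductive mode := Same of bool | Change | Insert of bool.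

Definition mode_code (X : mode) : bool + option bool :=
  match X with Same h => inl h | Change => inr None | Insert h => inr (Some h) end.
Definition mode_decode (x : bool + option bool) : mode :=
  match x with inl h => Same h | inr None => Change | inr (Some h) => Insert h end.
Lemma mode_codeK : cancel mode_code mode_decode. Proof. by case. Qed.
HB.instance Definition _ := Finite.copy mode (can_type mode_codeK).

Definition nonnil_before (X : mode) :=
  match X with Same h | Insert h => h | Change => true end.
Definition nonnil_after (X : mode) :=
  match X with Same h => h | _ => true end.
Definition marks_before (X : mode) : nat := if X is Change then 1 else 0.
Definition marks_after (X : mode) : nat := if X is Same _ then 0 else 1.

Inductive edit (G : Type) (n : nat) := Lamp of G | Move of letter n.
Arguments Lamp {G n}.
Arguments Move {G n}.

Section Edits.
Variables (n : nat) (A : finType) (L : set (seq A)) (u1 : seq A).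
Variables (G : groupType) (psi : seq A -> G).
Notation dir := (option (letter n)).
Notation flag := (dir * bool * bool * bool)%type.
Notation symbol := (option flag * A)%type.
Notation pair_symbol := (option symbol * option symbol)%type.
Local Notation forest := (forest n A).
Local Notation valid := (valid L u1).
Local Notation value_at := (value_at psi).
Implicit Types (t c s : forest) (d : dir) (D : {set dir}) (x : letter n).
Implicit Types (X Y Z : mode) (w : seq pair_symbol).

(** The flags of an unchanged label may differ on the two tracks, as the mark or
    the neighbouring vertices can change. *)
Definition both_flagged (fl fl' : flag) (u : seq A) : seq pair_symbol :=
  mark_head (fun a => (Some (Some fl, a), Some (Some fl', a)))
            (fun a => (Some (None, a), Some (None, a))) u.

Definition edit_flagged (fl : flag) (c : seq (option A * option A)) : seq pair_symbol :=
  mark_head (fun o => (omap (pair (Some fl)) o.1, omap (pair (Some fl)) o.2))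
            (fun o => (omap (pair None) o.1, omap (pair None) o.2)) c.

Variable k : edit G n.

(** The vertices whose label is kept, with their marks before and after and the
    modes of their children and of their later siblings. *)
Inductive keep_rule : mode -> dir -> bool -> bool -> mode -> mode -> Prop :=
| Keep_same d hc hs : keep_rule (Same true) d false false (Same hc) (Same hs)
| Keep_child d hs : keep_rule Change d false false Change (Same hs)
| Keep_sibling d hc : keep_rule Change d false false (Same hc) Change
| Keep_leave x d hc hs of k = Move x :
    keep_rule Change d true false (Insert hc) (Same hs)
| Keep_enter x hc hs of k = Move x :
    keep_rule (Insert true) (Some x) false true (Same hc) (Same hs)
| Keep_before d hc hs : keep_rule (Insert true) d false false (Same hc) (Insert hs).

(** The edit turns the first forest into the second; the word aligns their codes
    vertex by vertex, so that only the edited label contributes gaps. A position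
    that arrives at a new vertex creates a leaf with the label of the unit. *)
Inductive edits : mode -> {set dir} -> forest -> forest -> seq pair_symbol -> Prop :=
| Edits_void D : edits (Same false) D Void Void [::]
| Edits_keep X D d mk mk' u c c' s s' wc ws Y Z of d \in D & L u &
    [|| mk, nonnil_before Y | u != u1] & keep_rule X d mk mk' Y Z &
    edits Y (child_dirs d) c c' wc & edits Z (later_dirs d D) s s' ws :
    edits X D (Vertex d mk u c s) (Vertex d mk' u c' s')
      (both_flagged (d, mk, nonnil_before Y, nonnil_before Z)
                    (d, mk', nonnil_after Y, nonnil_after Z) u ++ wc ++ ws)
| Edits_lamp h D d u v c c' s s' wc ws hc hs of k = Lamp h & d \in D & L u & L v &
    psi u * h = psi v &
    edits (Same hc) (child_dirs d) c c' wc & edits (Same hs) (later_dirs d D) s s' ws :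
    edits Change D (Vertex d true u c s) (Vertex d true v c' s')
      (edit_flagged (d, true, hc, hs) (convolution u v) ++ wc ++ ws)
| Edits_new x D s s' ws h of k = Move x & Some x \in D &
    edits (Same h) (later_dirs (Some x) D) s s' ws :
    edits (Insert h) D s (Vertex (Some x) true u1 Void s')
      (edit_flagged (Some x, true, false, h) (convolution [::] u1) ++ ws).

Section Grammar.
Local Notation terminal := ((flag * flag * bool) + flag)%type.

Definition edit_labels : set (seq (option A * option A)) :=
  match k with
  | Lamp h => [set w | exists u v, [/\ L u, L v, psi u * h = psi v & w = convolution u v]]
  | Move _ => [set convolution [::] u1]
  end.

Definition terminal_language (a : terminal) : set (seq pair_symbol) :=
  match a with
  | inl (fl, fl', leaf) => both_flagged fl fl' @` [set u | L u /\ (leaf ==> (u != u1))]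
  | inr fl => edit_flagged fl @` edit_labels
  end.

Inductive edit_rule : mode * {set dir} -> terminal ->
    mode * {set dir} -> mode * {set dir} -> Prop :=
| Rule_keep X D d mk mk' Y Z of d \in D & keep_rule X d mk mk' Y Z :
    edit_rule (X, D)
      (inl ((d, mk, nonnil_before Y, nonnil_before Z),
            (d, mk', nonnil_after Y, nonnil_after Z), ~~ (mk || nonnil_before Y)))
      (Y, child_dirs d) (Z, later_dirs d D)
| Rule_lamp h D d hc hs of k = Lamp h & d \in D :
    edit_rule (Change, D) (inr (d, true, hc, hs))
      (Same hc, child_dirs d) (Same hs, later_dirs d D)
| Rule_new x D h of k = Move x & Some x \in D :
    edit_rule (Insert h, D) (inr (Some x, true, false, h))
      (Same false, finset.set0) (Same h, later_dirs (Some x) D).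

Lemma edits_same_false D t t' w : edits (Same false) D t t' w ->
  [/\ t = Void, t' = Void & w = [::]].
Proof.
move EX : (Same false) => X e; case: e EX => // {}X D' d mk mk' u c c' s s' wc ws Y Z _ _ _.
by case=> // ? ? ? E; case: E.
Qed.

(** The rules of the grammar are those of [edits] with the forests forgotten; a new
    vertex has no children, which is expressed by an erasable nonterminal. *)
Lemma gen_edits X D w :
  gen (fun N => N.1 = Same false) edit_rule terminal_language (X, D) w <->
  exists t t', edits X D t t' w.
Proof.
split=> [g|[t [t' e]]].
  rewrite -[X]/((X, D).1) -[D]/((X, D).2); move: (X, D) g => N.
  elim=> {X D N w} [[X D] /= ->|N a Y Z w0 w1 w2 r].
    by exists Void, Void; apply: Edits_void.
  case: r => [X D d mk mk' {}Y {}Z dD kr|h D d hc hs kL dD|x D h kM xD] /=.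
  - move=> [u [Lu leaf] <-] _ [c [c' ec]] _ [s [s' es]].
    exists (Vertex d mk u c s), (Vertex d mk' u c' s'); apply: Edits_keep => //.
    by rewrite orbA -implyNb.
  - rewrite /edit_labels kL.
    move=> [_ [u [v [Lu Lv uv ->]]] <-] _ [c [c' ec]] _ [s [s' es]].
    by exists (Vertex d true u c s), (Vertex d true v c' s'); apply: (Edits_lamp kL).
  - rewrite /edit_labels kM.
    move=> [_ -> <-] _ [c [c' /edits_same_false[_ _ ->]]] _ [s [s' es]].
    by exists s, (Vertex (Some x) true u1 Void s'); apply: Edits_new.
elim: e => {X D t t' w}
  [D|X D d mk mk' u c c' s s' wc ws Y Z dD Lu leaf kr _ gc _ gs
  |h D d u v c c' s s' wc ws hc hs kL dD Lu Lv uv _ gc _ gs|x D s s' ws h kM xD _ gs].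
- exact: Gen_nil.
- apply: Gen_rule (Rule_keep dD kr) _ gc gs; exists u => //; split=> //.
  by rewrite implyNb -orbA.
- apply: Gen_rule (Rule_lamp _ _ kL dD) _ gc gs; exists (convolution u v) => //.
  by rewrite /edit_labels kL; exists u, v.
- rewrite -[ws]cat0s; apply: Gen_rule (Rule_new _ kM xD) _ (Gen_nil _ _ _) gs => //.
  by exists (convolution [::] u1) => //; rewrite /edit_labels kM.
Qed.

Lemma context_free_edits D : context_free L -> L u1 ->
  (forall h, k = Lamp h -> context_free edit_labels) ->
  context_free [set w | exists t t', edits Change D t t' w].
Proof.
move=> cfL Lu1 cfE.
suff cfT a : context_free (terminal_language a).
  by apply: eq_context_free (context_free_gen _ _ _ cfT) => w; apply: gen_edits.
case: a => [[[fl fl'] leaf]|fl]; apply: context_free_mark_head.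
  apply: eq_context_free (context_free_filter_eq u1 (fun b => leaf ==> ~~ b) cfL).
  by move=> u.
case Ek : k (cfE) => [h|x] cfE'; first exact: (cfE' h).
rewrite /edit_labels Ek.
apply: eq_context_free (context_free_map (fun a => (None, Some a))
  (context_free_filter_eq u1 id cfL)) => w.
rewrite convolution_nil_l; split=> [[u [_ /eqP ->] <-]//|->].
by exists u1.
Qed.

End Grammar.

Lemma track1_both fl fl' u : track1 (both_flagged fl fl' u) = flagged fl u.
Proof. by case: u => //= a u; congr cons; elim: u => //= b u ->. Qed.

Lemma track2_both fl fl' u : track2 (both_flagged fl fl' u) = flagged fl' u.
Proof. by case: u => //= a u; congr cons; elim: u => //= b u ->. Qed.

Lemma gaps_both fl fl' u : gaps (both_flagged fl fl' u) = 0%N.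
Proof. by case: u => //= a u; rewrite /gaps /=; elim: u. Qed.

Lemma gaps_edit fl (c : seq (option A * option A)) : gaps (edit_flagged fl c) = gaps c.
Proof.
have gaps_map (f : option flag) (c0 : seq (option A * option A)) :
    gaps [seq (omap (pair f) o.1, omap (pair f) o.2) | o <- c0] = gaps c0.
  by rewrite /gaps count_map; apply: eq_count => -[[?|] [?|]].
case: c => // o c; rewrite -[RHS](gaps_map None) /= /gaps /=.
by case: o => [[?|] [?|]].
Qed.

Lemma track1_map_edit (f : option flag) (c : seq (option A * option A)) :
  track1 [seq (omap (pair f) o.1, omap (pair f) o.2) | o <- c] = map (pair f) (track1 c).
Proof. by elim: c => //= -[[a|] o] c /= ->. Qed.

Lemma track2_map_edit (f : option flag) (c : seq (option A * option A)) :
  track2 [seq (omap (pair f) o.1, omap (pair f) o.2) | o <- c] = map (pair f) (track2 c).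
Proof. by elim: c => //= -[o [a|]] c /= ->. Qed.

Lemma track1_edit fl u v : v != [::] ->
  track1 (edit_flagged fl (convolution u v)) = flagged fl u.
Proof.
case: u v => [|a u] [|b v] // _.
- rewrite convolution_nil_l /= track1_map_edit.
  by elim: v.
- by rewrite convolution_cons /= track1_map_edit track1_convolution.
Qed.

Lemma track2_edit fl u v : v != [::] ->
  track2 (edit_flagged fl (convolution u v)) = flagged fl v.
Proof.
case: u v => [|a u] [|b v] // _.
- rewrite convolution_nil_l /= track2_map_edit; congr cons.
  by congr map; elim: v => //= x v ->.
- by rewrite convolution_cons /= track2_map_edit track2_convolution.
Qed.

End Edits.

Section EditTheory.
Variables (n : nat) (A : finType) (L : set (seq A)) (u1 : seq A).
Variables (G : groupType) (psi : seq A -> G).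
Hypotheses (L_nil : ~ L [::]) (Lu1 : L u1) (psi_u1 : psi u1 = 1).
Hypothesis psi_inj : forall u v, L u -> L v -> psi u = psi v -> u = v.
Hypothesis psi_surj : forall h, exists2 u, L u & psi u = h.
Notation dir := (option (letter n)).
Notation flag := (dir * bool * bool * bool)%type.
Notation symbol := (option flag * A)%type.
Notation pair_symbol := (option symbol * option symbol)%type.
Local Notation F := (free_group n).
Local Notation forest := (forest n A).
Local Notation valid := (valid L u1).
Local Notation value_at := (value_at psi).
Local Notation edits := (edits L u1 psi).
Implicit Types (t c s : forest) (d : dir) (D : {set dir}) (x : letter n).
Implicit Types (X Y Z : mode) (w : seq pair_symbol) (k : edit G n).

Lemma L_neq0 u : L u -> u != [::].
Proof. by case: u. Qed.

Lemma later_dirs_mono d D D' : D \subset D' -> later_dirs d D \subset later_dirs d D'.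
Proof. by move=> /fintype.subsetP DD'; apply/fintype.subsetP=> y; rewrite !inE => /andP[/DD' -> ->]. Qed.

Lemma valid_mono D D' t : D \subset D' -> valid D t -> valid D' t.
Proof.
elim: t D D' => //= d m u c _ s IHs D D' DD' [dD Lu leaf vc vs].
by split=> //; [apply: (fintype.subsetP DD') | apply: (IHs _ _ (later_dirs_mono d DD'))].
Qed.

Lemma later_dirs_sub d D : later_dirs d D \subset D.
Proof. by apply/fintype.subsetP => y; rewrite inE => /andP[]. Qed.

Lemma edits_shape k X D t t' w : edits k X D t t' w ->
  [/\ nonnil t = nonnil_before X, nonnil t' = nonnil_after X,
      marks t = marks_before X & marks t' = marks_after X].
Proof.
elim=> {X D t t' w}
  [D|X D d mk mk' u c c' s s' wc ws Y Z _ _ _ kr _ [nc nc' mc mc'] _ [ns ns' ms ms']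
  |h D d u v c c' s s' wc ws hc hs _ _ _ _ _ _ [nc nc' mc mc'] _ [ns ns' ms ms']
  |x D s s' ws h _ _ _ [ns ns' ms ms']] //=.
- by rewrite mc mc' ms ms'; case: kr.
- by rewrite mc mc' ms ms'.
- by rewrite ms'.
Qed.

Lemma edits_same k h D t t' w : edits k (Same h) D t t' w -> t = t'.
Proof.
move EX: (Same h) => X e; elim: e h EX => {X D t t' w}
  [//|X D d mk mk' u c c' s s' wc ws Y Z _ _ _ kr _ IHc _ IHs h|//|//].
by case: kr IHc IHs => // d0 hc hs IHc IHs _; rewrite (IHc _ erefl) (IHs _ erefl).
Qed.

Lemma edits_valid k X D t t' w : edits k X D t t' w -> valid D t /\ valid D t'.
Proof.
elim=> {X D t t' w}
  [D|X D d mk mk' u c c' s s' wc ws Y Z dD Lu leaf kr ec [vc vc'] es [vs vs']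
  |h D d u v c c' s s' wc ws hc hs _ dD Lu Lv _ ec [vc vc'] es [vs vs']
  |x D s s' ws h _ xD es [vs vs']] //=.
- have [nc nc' _ _] := edits_shape ec; split; split=> //; rewrite ?nc ?nc' //.
  by case: kr leaf => //= *; rewrite ?orbT.
- split; first exact: valid_mono (later_dirs_sub _ _) vs.
  by split.
Qed.

Lemma edits_tracks k X D t t' w : edits k X D t t' w ->
  track1 w = enc t /\ track2 w = enc t'.
Proof.
elim=> {X D t t' w}
  [D|X D d mk mk' u c c' s s' wc ws Y Z _ _ _ _ ec [c1 c2] es [s1 s2]
  |h D d u v c c' s s' wc ws hc hs _ _ _ Lv _ ec [c1 c2] es [s1 s2]
  |x D s s' ws h _ _ es [s1 s2]] //=.
- have [-> -> _ _] := edits_shape ec; have [-> -> _ _] := edits_shape es.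
  by rewrite !track1_cat !track2_cat track1_both track2_both c1 c2 s1 s2.
- have [/= -> -> _ _] := edits_shape ec; have [/= -> -> _ _] := edits_shape es.
  rewrite !track1_cat !track2_cat track1_edit ?track2_edit ?L_neq0 //.
  by rewrite c1 c2 s1 s2.
- have [/= _ -> _ _] := edits_shape es.
  rewrite !track1_cat !track2_cat track1_edit ?track2_edit ?L_neq0 //.
  by rewrite s1 s2.
Qed.

(** Only the edited label is misaligned. *)
Lemma edits_gaps k K X D t t' w :
  (forall e, edit_labels L u1 psi k e -> (gaps e <= K)%N) ->
  edits k X D t t' w -> (gaps w <= if X is Same _ then 0 else K)%N.
Proof.
move=> Kb; elim=> {X D t t' w}
  [D|X D d mk mk' u c c' s s' wc ws Y Z _ _ _ kr _ gc _ gs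
  |h D d u v c c' s s' wc ws hc hs kL _ Lu Lv uv _ gc _ gs
  |x D s s' ws h kM _ _ gs] //=.
- by rewrite !gaps_cat gaps_both add0n; case: kr gc gs => /= *; lia.
- rewrite !gaps_cat gaps_edit.
  have := Kb (convolution u v); rewrite /edit_labels kL => /(_ _)/[dup].
  have E : exists u0 v0, [/\ L u0, L v0, psi u0 * h = psi v0 & convolution u v = convolution u0 v0].
    by exists u, v.
  by move=> /(_ E) ? _; lia.
- rewrite !gaps_cat gaps_edit.
  by have := Kb (convolution [::] u1); rewrite /edit_labels kM => /(_ erefl); lia.
Qed.

Definition edit_target k (p : seq dir) := if k is Move x then rcons p (Some x) else p.
Definition edit_factor k : G := if k is Lamp h then h else 1.

Lemma marks0_value_out D t p d : valid (later_dirs d D) t ->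
  value_at t (d :: p) = 1 /\ marked_at t (d :: p) = false.
Proof.
move=> vt; split.
  apply/eqP; apply: contraT => /(value_at_in_tree vt)/in_tree_later_head.
  by rewrite eqxx.
by apply: contraTF isT => /(marked_at_in_tree vt)/in_tree_later_head; rewrite eqxx.
Qed.

(** Along the path to the position all vertices are kept; there a lamp changes the
    value, while a move lengthens the path by [x]. While the position has not yet
    arrived ([Insert]) the only change is the mark on [x], since a new vertex has
    the value 1 that an absent one has. *)
Lemma edits_semantics k X D t t' w : edits k X D t t' w ->
  match X with
  | Same _ => True
  | Change => exists d p, [/\ d \in D, forall q, marked_at t q = (q == d :: p),
      forall q, marked_at t' q = (q == edit_target k (d :: p)) &
      forall q, value_at t' q = value_at t q * (if q == d :: p then edit_factor k else 1)]
  | Insert _ => exists x, [/\ k = Move x, Some x \in D,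
      forall q, marked_at t' q = (q == [:: Some x]) &
      forall q, value_at t' q = value_at t q]
  end.
Proof.
elim=> {X D t t' w}
  [D|X D d mk mk' u c c' s s' wc ws Y Z dD Lu leaf kr ec IHc es IHs
  |h D d u v c c' s s' wc ws hc hs kL dD Lu Lv uv ec _ es _
  |x D s s' ws h kM xD es _] //=.
- have [_ _ mc mc'] := edits_shape ec; have [_ _ ms ms'] := edits_shape es.
  have [vc vc'] := edits_valid ec; have [vs vs'] := edits_valid es.
  case: kr dD ec es IHc IHs mc mc' ms ms' vc vc' vs vs' {leaf}
    => [//|{}d hs|{}d hc|x {}d hc hs kM|x hc hs kM|{}d hc hs] dD ec es IHc IHs /=
       mc mc' ms ms' vc vc' vs vs'.
  + have [e [p [eD m0 m1 v]]] := IHc; have ss' := edits_same es; subst s'.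
    exists d, (e :: p); split=> // -[|q0 q] //=.
    * case: (q0 =P d) => [->|/eqP/negPf nq]; last first.
        by rewrite eqseq_cons nq /= marks0_marked_at.
      by rewrite eqseq_cons eqxx /=; case: q => [|q1 q].
    * by rewrite /edit_target; case: (k).
    * have -> : edit_target k [:: d, e & p] = d :: edit_target k (e :: p).
        by rewrite /edit_target; case: (k).
      case: (q0 =P d) => [->|/eqP/negPf nq]; last first.
        by rewrite eqseq_cons nq /= marks0_marked_at.
      rewrite eqseq_cons eqxx /=; case: q => [|q1 q //].
      by rewrite /edit_target; case: (k).
    * by rewrite mulg1.
    * rewrite eqseq_cons; case: (q0 =P d) => _ /=; last by rewrite mulg1.
      by case: q => [|q1 q]; rewrite ?mulg1.
  + have [e [p [eD m0 m1 v]]] := IHs; have cc' := edits_same ec; subst c'.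
    have ned : (d == e) = false.
      by apply: contraTF eD => /eqP ->; rewrite inE ltnn andbF.
    exists e, p; split=> [|[|q0 q]|[|q0 q]|[|q0 q]] //=.
    * exact: (fintype.subsetP (later_dirs_sub d D)).
    * case: (q0 =P d) => [->|_]; last exact: m0.
      rewrite eqseq_cons ned /=.
      by case: q => // *; rewrite marks0_marked_at.
    * by rewrite /edit_target; case: (k).
    * case: (q0 =P d) => [->|_]; last exact: m1.
      have -> : (d :: q == edit_target k (e :: p)) = false.
        by rewrite /edit_target; case: (k) => [_|x] /=; rewrite eqseq_cons ned.
      by case: q => // *; rewrite marks0_marked_at.
    * by rewrite mulg1.
    * case: (q0 =P d) => [->|_]; last exact: v.
      by rewrite eqseq_cons ned mulg1.
  + have [y [kM' xD m1 v]] := IHc; have ss' := edits_same es; subst s'.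
    rewrite kM /=; exists d, [::]; split=> // -[|q0 q] //=.
    * rewrite eqseq_cons; case: (q0 =P d) => [_|_] /=; last by rewrite marks0_marked_at.
      by case: q => // *; rewrite marks0_marked_at.
    * rewrite eqseq_cons; case: (q0 =P d) => [_|_] /=; last by rewrite marks0_marked_at.
      have yx : y = x by move: kM'; rewrite kM => -[].
      by case: q => // *; rewrite m1 yx.
    * by rewrite mulg1.
    * by rewrite if_same mulg1; case: ifP => // _; case: q.
  + have cc' := edits_same ec; have ss' := edits_same es; subst c' s'.
    exists x; split=> // -[|q0 q] //=; rewrite eqseq_cons.
    case: (q0 =P Some x) => _ /=; last by rewrite marks0_marked_at.
    by case: q => // *; rewrite marks0_marked_at.
  + have [x [kM xD m1 v]] := IHs; have cc' := edits_same ec; subst c'.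
    have ned : (d == Some x) = false.
      by apply: contraTF xD => /eqP ->; rewrite inE ltnn andbF.
    exists x; split=> // [|[|q0 q]|[|q0 q]] //=.
    * exact: (fintype.subsetP (later_dirs_sub d D)).
    * case: (q0 =P d) => [->|_]; last exact: m1.
      rewrite eqseq_cons ned /=.
      by case: q => // *; rewrite marks0_marked_at.
    * by case: (q0 =P d) => // ->; rewrite v.
- have [_ _ mc _] := edits_shape ec; have [_ _ ms _] := edits_shape es.
  have cc' := edits_same ec; have ss' := edits_same es; subst c' s'.
  have out q0 q : (if q0 == d then if q is [::] then true else marked_at c q
      else marked_at s (q0 :: q)) = (q0 :: q == [:: d]).
    rewrite eqseq_cons; case: (q0 =P d) => _ /=; last by rewrite marks0_marked_at.
    by case: q => // *; rewrite marks0_marked_at.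
  rewrite kL /=; exists d, [::]; split=> // -[|q0 q] //=; rewrite ?out ?mulg1 //.
  rewrite eqseq_cons; case: (q0 =P d) => _ /=; last by rewrite mulg1.
  by case: q => [|? ?]; rewrite ?mulg1.
- have [_ _ ms _] := edits_shape es; have ss' := edits_same es; subst s'.
  have [vs _] := edits_valid es.
  exists x; split=> // -[|q0 q] //=.
  + rewrite eqseq_cons; case: (q0 =P Some x) => _ /=; last by rewrite marks0_marked_at.
    by case: q.
  + by case: (s).
  + case: (q0 =P Some x) => [->|//].
    by rewrite (marks0_value_out q vs).1; case: q.
Qed.

Definition edit_element k : wreath G F :=
  match k with Lamp h => wr_lamp F h | Move x => wr_shift G (fg_letter x) end.

(** The entered child exists in a valid tree, so the path to it is a reduced word
    and appending [x] there is multiplication by [x]. *)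
Lemma edits_denotes k t t' w z : edits k Change (root_dirs n) t t' w ->
  denotes psi t z -> denotes psi t' (z * edit_element k).
Proof.
move=> e [mt vt]; have [_ vt'] := edits_valid e.
have [d [p [_ m0 m1 v]]] := edits_semantics e.
have posE : d :: p = tree_path (wr_pos z) by apply/esym/eqP; rewrite -m0 mt.
rewrite posE in m1 v.
case: k {e} m1 v => [h|x] /= m1 v; split=> b.
- by rewrite m1 wr_posM /= mulg1 (inj_eq (@tree_path_inj n)).
- rewrite v vt wr_mulE [wr_fun (wr_lamp _ _) _]fs_singleE (inj_eq (@tree_path_inj n)).
  by rewrite -(inj_eq (mulgI (wr_pos z)^-1) b) mulVg.
- have /in_root_treeP[b' b'E] := marked_at_in_tree vt' (etrans (m1 _) (eqxx _)).
  rewrite m1 b'E (inj_eq (@tree_path_inj n)); congr (b == _).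
  have wE : fg_word b' = rcons (fg_word (wr_pos z)) x.
    by move: b'E => [/eqP]; rewrite -map_rcons (inj_eq (inj_map Some_inj)) => /eqP.
  apply: val_inj => /=; rewrite wE fg_cat_rcons // -wE.
  by case: (b').
- by rewrite v vt if_same wr_mulE [wr_fun (wr_shift _ _) _]fsfunE.
Qed.

Lemma edits_same_total k D t : valid D t -> marks t = 0%N ->
  exists w, edits k (Same (nonnil t)) D t t w.
Proof.
elim: t D => [|d m u c IHc s IHs] D /=; first by exists [::]; apply: Edits_void.
move=> [dD Lu leaf vc vs] m0.
move: m0 => /eqP; rewrite !addn_eq0 eqb0 => /andP[/andP[/negPf mf /eqP mc] /eqP ms].
have [wc ec] := IHc _ vc mc; have [ws es] := IHs _ vs ms; rewrite mf in leaf *.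
by eexists; apply: (Edits_keep dD Lu _ (Keep_same k d _ _) ec es).
Qed.

(** The child along [x] is looked for among the siblings in increasing order; it
    is inserted before the first larger direction if it is absent. *)
Lemma edits_insert_total x D t : valid D t -> marks t = 0%N -> Some x \in D ->
  exists t' w, edits (Move x) (Insert (nonnil t)) D t t' w.
Proof.
elim: t D => [|d m u c _ s IHs] D.
  move=> _ _ xD; exists (Vertex (Some x) true u1 Void Void); eexists.
  by apply: (@Edits_new _ _ _ _ _ _ _ x) => //; apply: Edits_void.
move=> vt mt xD; have [dD Lu leaf vc vs] := vt; move: (mt) => /= mt'.
move: mt' => /eqP; rewrite !addn_eq0 eqb0 => /andP[/andP[/negPf mf /eqP mc] /eqP ms].
have [wc ec] := edits_same_total (Move x) vc mc.
have [dx|nd] := eqVneq d (Some x).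
  have [ws es] := edits_same_total (Move x) vs ms; subst d m.
  by eexists; eexists; apply: (Edits_keep dD Lu _ (@Keep_enter _ _ (Move x) x _ _ erefl) ec es).
have /orP[xd|dx] := later_dirs_total dD xD nd.
  have [s' [ws es]] := IHs _ vs ms xd; subst m.
  by eexists; eexists; apply: (Edits_keep dD Lu _ (Keep_before (Move x) d _ _) ec es).
have vt' : valid (later_dirs (Some x) D) (Vertex d m u c s).
  split=> //; apply: valid_mono vs; apply/fintype.subsetP => y; move: dx; rewrite !inE.
  by move=> /andP[_ xd] /andP[-> dy]; rewrite dy (ltn_trans xd dy).
have [w e] := edits_same_total (Move x) vt' mt.
by eexists; eexists; apply: (@Edits_new _ _ _ _ _ _ _ x _ _ _ _ _ erefl xD e).
Qed.

(** Since right multiplication by a lamp only replaces the label at the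
    position, it can be done and undone. *)
Lemma edits_lamp_total h D t : valid D t -> marks t = 1%N ->
  (exists t' w, edits (Lamp h) Change D t t' w) /\
  (exists t' w, edits (Lamp h) Change D t' t w).
Proof.
elim: t D => [|d m u c IHc s IHs] D //= [dD Lu leaf vc vs] mt.
case: m leaf mt => [_ mt|leaf].
  have [mc ms] : marks c = 0%N /\ marks s = 0%N by lia.
  have [wc ec] := edits_same_total (Lamp h) vc mc.
  have [ws es] := edits_same_total (Lamp h) vs ms.
  have [v Lv vE] := psi_surj (psi u * h); have [v' Lv' v'E] := psi_surj (psi u * h^-1).
  split; eexists; eexists.
    exact: (Edits_lamp erefl dD Lu Lv (esym vE) ec es).
  by apply: (Edits_lamp erefl dD Lv' Lu _ ec es); rewrite v'E mulgVK.
rewrite add0n; case mc: (marks c) => [|i] mt.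
  have [wc ec] := edits_same_total (Lamp h) vc mc.
  have [[s' [ws es]] [s0 [ws0 es0]]] := IHs _ vs mt.
  split; eexists; eexists.
    by apply: (Edits_keep dD Lu _ (Keep_sibling _ _ _) ec es).
  by apply: (Edits_keep dD Lu _ (Keep_sibling _ _ _) ec es0).
have [mc1 ms] : marks c = 1%N /\ marks s = 0%N by lia.
have [ws es] := edits_same_total (Lamp h) vs ms.
have [[c' [wc ec]] [c0 [wc0 ec0]]] := IHc _ vc mc1.
by split; eexists; eexists; [apply: (Edits_keep dD Lu _ (Keep_child _ _ _) ec es)
  |apply: (Edits_keep dD Lu _ (Keep_child _ _ _) ec0 es)].
Qed.

(** Right multiplication by [x] either enters a child of the position, or goes
    back to its parent and so undoes an entrance along the inverse of [x]. In the
    third case the parent lies outside of the given forest. *)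
Lemma edits_move_total x D t : valid D t -> marks t = 1%N ->
  [\/ exists t' w, edits (Move x) Change D t t' w,
      exists t' w, edits (Move (letter_inv x)) Change D t' t w |
      exists h t' w, edits (Move (letter_inv x)) (Insert h) D t' t w].
Proof.
elim: t D => [|d m u c IHc s IHs] D // vt; have [dD Lu leaf vc vs] := vt => /= mt.
case: m vt leaf mt => [vt _ mt|vt leaf].
  have [mc ms] : marks c = 0%N /\ marks s = 0%N by lia.
  have [dx|ndx] := eqVneq d (Some (letter_inv x)); last first.
    have xc : Some x \in child_dirs d by rewrite inE.
    have [c' [wc ec]] := edits_insert_total vc mc xc.
    have [ws es] := edits_same_total (Move x) vs ms.
    apply: Or31; eexists; eexists.
    by apply: (Edits_keep dD Lu _ (Keep_leave _ _ _ erefl) ec es).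
  have [ws es] := edits_same_total (Move (letter_inv x)) vs ms.
  apply: Or33; subst d; have [/andP[/eqP c0 /eqP uE]|nleaf] := boolP (~~ nonnil c && (u == u1)).
    subst u; have -> : c = Void by case: (c) c0.
    by eexists; eexists; eexists; apply: (@Edits_new _ _ _ _ _ _ _ (letter_inv x) _ _ _ _ _ erefl dD es).
  have [wc ec] := edits_same_total (Move (letter_inv x)) vc mc.
  eexists; eexists; eexists.
  apply: (Edits_keep (mk := false) dD Lu _ (Keep_enter _ _ erefl) ec es).
  by move: nleaf; rewrite negb_and negbK.
rewrite add0n; case mc: (marks c) => [|i] mt.
  have wec k := edits_same_total k vc mc.
  case: (IHs _ vs mt) => [[s' [ws es]]|[s' [ws es]]|[h [s' [ws es]]]].
  - have [wc ec] := wec (Move x); apply: Or31; eexists; eexists.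
    by apply: (Edits_keep dD Lu _ (Keep_sibling _ _ _) ec es).
  - have [wc ec] := wec (Move (letter_inv x)); apply: Or32; eexists; eexists.
    by apply: (Edits_keep dD Lu _ (Keep_sibling _ _ _) ec es).
  - have [wc ec] := wec (Move (letter_inv x)); apply: Or33; eexists; eexists; eexists.
    by apply: (Edits_keep dD Lu _ (Keep_before _ _ _ _) ec es).
have [mc1 ms] : marks c = 1%N /\ marks s = 0%N by lia.
have wes k := edits_same_total k vs ms.
case: (IHc _ vc mc1) => [[c' [wc ec]]|[c' [wc ec]]|[h [c' [wc ec]]]].
- have [ws es] := wes (Move x); apply: Or31; eexists; eexists.
  by apply: (Edits_keep dD Lu _ (Keep_child _ _ _) ec es).
- have [ws es] := wes (Move (letter_inv x)); apply: Or32; eexists; eexists.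
  by apply: (Edits_keep dD Lu _ (Keep_child _ _ _) ec es).
- have [ws es] := wes (Move (letter_inv x)); apply: Or32; eexists; eexists.
  by apply: (Edits_keep dD Lu _ (Keep_leave _ _ _ erefl) ec es).
Qed.

End EditTheory.

(** * The representation of the wreath product *)

Section Representation.
Variables (n m : nat) (A : finType) (L : set (seq A)) (u1 : seq A).
Variables (G : groupType) (g : 'I_m -> G) (psi : seq A -> G) (K : nat).
Hypotheses (gen_g : generates g) (cf_L : context_free L).
Hypotheses (L_nil : ~ L [::]) (Lu1 : L u1) (psi_u1 : psi u1 = 1).
Hypothesis psi_inj : forall u v, L u -> L v -> psi u = psi v -> u = v.
Hypothesis psi_surj : forall h, exists2 u, L u & psi u = h.
Hypothesis cf_g : forall j, context_free (edit_labels L u1 psi (Lamp (g j) : edit G n)).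
Hypothesis gaps_g : forall j u v, L u -> L v -> psi u * g j = psi v ->
  (gaps (convolution u v) <= K)%N.
Hypothesis u1_le : (size u1 <= K)%N.

Notation flag := (option (letter n) * bool * bool * bool)%type.
Notation symbol := (option flag * A)%type.
Local Notation F := (free_group n).
Local Notation W := (wreath G F).
Local Notation forest := (forest n A).
Local Notation S := (@wreath_gens G m n g).
Local Notation edits := (edits L u1 psi).
Local Notation denotes := (denotes psi).
Implicit Types (t : forest) (z : W).

Definition represents t := valid L u1 (root_dirs n) t /\ marks t = 1%N.

Definition wr_lang : set (seq symbol) := [set w | exists2 t, represents t & w = enc t].

Definition wr_psi (w : seq symbol) : W :=
  xget 1 [set z | exists t, [/\ represents t, w = enc t & denotes t z]].

Lemma represents_enc_inj t t' : represents t -> represents t' -> enc t = enc t' -> t = t'.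
Proof. by move=> [v _] [v' _]; apply: (enc_inj L_nil v v'). Qed.

Lemma wr_psi_enc t : represents t -> denotes t (wr_psi (enc t)).
Proof.
move=> rt; rewrite /wr_psi; set P := (X in xget _ X).
have [w _ tw] := tour_root psi gen_g rt.1 rt.2.
have Pw : P (word_eval S w) by exists t.
case: (xgetP 1 P) => [z _ [t' [rt' /(represents_enc_inj rt rt') <-]]//|/(_ _ Pw)//].
Qed.

(** A move along a free generator either enters a child, or goes back to the
    parent; the latter is an entrance along the inverse letter, read backwards. *)
Definition steps (i : 'I_m + 'I_n) t t' : Prop :=
  match i with
  | inl j => exists w, edits (Lamp (g j)) Change (root_dirs n) t t' w
  | inr x => (exists w, edits (Move (x, true)) Change (root_dirs n) t t' w) \/
             (exists w, edits (Move (x, false)) Change (root_dirs n) t' t w)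
  end.

Lemma edits_represents k t t' w : edits k Change (root_dirs n) t t' w ->
  represents t /\ represents t'.
Proof.
move=> e; have [v v'] := edits_valid Lu1 e.
by have [_ _ mt mt'] := edits_shape e.
Qed.

Lemma steps_represents i t t' : steps i t t' -> represents t /\ represents t'.
Proof.
case: i => [j [w /edits_represents//]|x [[w /edits_represents//]|[w /edits_represents[]//]]].
Qed.

Lemma steps_denotes i t t' z : steps i t t' -> denotes t z -> denotes t' (z * S i).
Proof.
case: i => [j [w e]|x [[w e]|[w e]]] tz.
- exact: (edits_denotes Lu1 psi_u1 e tz).
- by have := edits_denotes Lu1 psi_u1 e tz; rewrite /= fg_letterE.
- have [rt' _] := edits_represents e.
  have t'y := wr_psi_enc rt'.
  have := denotes_unique tz (edits_denotes Lu1 psi_u1 e t'y).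
  by rewrite /= fg_letterE /= -wr_shiftV => ->; rewrite mulgVK.
Qed.

Lemma steps_total i t : represents t ->
  (exists t', steps i t t') /\ (exists t', steps i t' t).
Proof.
move=> [vt mt]; case: i => [j|x] /=.
  have [[t1 e1] [t2 e2]] := edits_lamp_total psi_surj (g j) vt mt.
  by split; [exists t1|exists t2].
have no_insert k h t' w : ~ edits k (Insert h) (root_dirs n) t' t w.
  by move=> /(edits_semantics Lu1 psi_u1)[y [_ +]]; rewrite inE.
split.
  have [[t' [w e]]|[t' [w e]]|[h [t' [w /no_insert//]]]] := edits_move_total psi (x, true) vt mt.
    by exists t'; left; exists w.
  by exists t'; right; exists w.
have [[t' [w e]]|[t' [w e]]|[h [t' [w /no_insert//]]]] := edits_move_total psi (x, false) vt mt.
  by exists t'; right; exists w.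
by exists t'; left; exists w.
Qed.

Lemma edit_labels_gaps (k : edit G n) e : (forall h, k = Lamp h -> exists j, h = g j) ->
  edit_labels L u1 psi k e -> (gaps e <= K)%N.
Proof.
case: k => [h /(_ _ erefl)[j ->]|x _]; rewrite /edit_labels.
  by move=> [u [v [Lu Lv uv ->]]]; apply: (gaps_g Lu Lv uv).
by move=> ->; rewrite gaps_convolution sub0n subn0 add0n.
Qed.

Lemma edits_gaps_le (k : edit G n) t t' w : (forall h, k = Lamp h -> exists j, h = g j) ->
  edits k Change (root_dirs n) t t' w -> (gaps w <= K)%N.
Proof. by move=> kg; apply: edits_gaps => e; apply: edit_labels_gaps. Qed.

Lemma steps_size i t t' : steps i t t' ->
  (size (enc t') <= size (enc t) + K)%N /\ (size (enc t) <= size (enc t') + K)%N.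
Proof.
have sizes (k : edit G n) t0 t0' w : (forall h, k = Lamp h -> exists j, h = g j) ->
    edits k Change (root_dirs n) t0 t0' w ->
    (size (enc t0') <= size (enc t0) + K)%N /\ (size (enc t0) <= size (enc t0') + K)%N.
  move=> kg e; have [<- <-] := edits_tracks L_nil Lu1 e; have le_K := edits_gaps_le kg e.
  by split; [apply: leq_trans (size_track1_le w) _|apply: leq_trans (size_track2_le w) _];
    rewrite leq_add2l.
case: i => [j [w e]|x [[w e]|[w e]]].
- by apply: sizes e => h [<-]; exists j.
- exact: sizes e.
- by have [] := sizes _ _ _ _ _ e.
Qed.

Lemma edits_context_free (k : edit G n) : (forall h, k = Lamp h -> exists j, h = g j) ->
  context_free [set w | exists t t', edits k Change (root_dirs n) t t' w].
Proof.
move=> kg; apply: context_free_edits => // h kh; have [j hj] := kg h kh.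
by rewrite kh hj.
Qed.

Lemma context_free_aligned (k : edit G n) : (forall h, k = Lamp h -> exists j, h = g j) ->
  context_free [set w | exists t t', (exists w', edits k Change (root_dirs n) t t' w') /\
                                     w = convolution (enc t) (enc t')].
Proof.
move=> kg; have cf := edits_context_free kg.
apply: eq_context_free (context_free_convolution (k := K) _ cf) => [w|c]; last first.
  by move=> [t [t' /(edits_gaps_le kg)]].
split=> [[c [t [t' e]] ->]|[t [t' [[c e] ->]]]].
  by have [-> ->] := edits_tracks L_nil Lu1 e; exists t, t'; split=> //; exists c.
by exists c; [exists t, t' | have [-> ->] := edits_tracks L_nil Lu1 e].
Qed.

Lemma context_free_aligned_swap (k : edit G n) : (forall h, k = Lamp h -> exists j, h = g j) ->
  context_free [set w | exists t t', (exists w', edits k Change (root_dirs n) t' t w') /\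
                                     w = convolution (enc t) (enc t')].
Proof.
pose swap (T : Type) (x : option T * option T) := (x.2, x.1).
have track1_swap (T : Type) (c : seq (option T * option T)) : track1 (map (@swap T) c) = track2 c.
  by elim: c => //= -[o1 [a|]] c /= ->.
have track2_swap (T : Type) (c : seq (option T * option T)) : track2 (map (@swap T) c) = track1 c.
  by elim: c => //= -[[a|] o2] c /= ->.
have gaps_swap (T : Type) (c : seq (option T * option T)) : gaps (map (@swap T) c) = gaps c.
  by rewrite /gaps count_map; apply: eq_count => -[[?|] [?|]].
move=> kg; have cf := context_free_map (@swap symbol) (edits_context_free kg).
apply: eq_context_free (context_free_convolution (k := K) _ cf) => [w|c]; last first.
  by move=> [c' [t [t' /(edits_gaps_le kg) le_K]] <-]; rewrite gaps_swap.
split=> [[c [c' [t [t' e]] <-] ->]|[t [t' [[c e] ->]]]].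
  rewrite track1_swap track2_swap.
  by have [-> ->] := edits_tracks L_nil Lu1 e; exists t', t; split=> //; exists c'.
exists (map (@swap symbol) c); first by exists c => //; exists t', t.
by rewrite track1_swap track2_swap; have [-> ->] := edits_tracks L_nil Lu1 e.
Qed.

Lemma context_free_steps i :
  context_free [set w | exists t t', steps i t t' /\ w = convolution (enc t) (enc t')].
Proof.
case: i => [j|x].
  by apply: context_free_aligned => h [<-]; exists j.
apply: eq_context_free (context_freeU
  (@context_free_aligned (Move (x, true)) _) (@context_free_aligned_swap (Move (x, false)) _)) => // w.
split=> [[|]|] [t [t' [st ->]]].
- by exists t, t'; split=> //; left.
- by exists t, t'; split=> //; right.
- by case: st => st; [left|right]; exists t, t'.
Qed.

(** A tree that denotes the product is the one that [steps] reaches, since [steps]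
    is total and a tree is determined by what it denotes. *)
Lemma wr_psi_steps i t t' : represents t -> represents t' ->
  wr_psi (enc t) * S i = wr_psi (enc t') <-> steps i t t'.
Proof.
move=> rt rt'; have tz := wr_psi_enc rt; have tz' := wr_psi_enc rt'; split=> [E|st].
  have [[t2 st2] _] := steps_total i rt; have [_ rt2] := steps_represents st2.
  have := steps_denotes st2 tz; rewrite E => t2z.
  by rewrite (denotes_inj Lu1 psi_u1 psi_inj rt'.1 rt2.1 tz' t2z).
exact: denotes_unique (steps_denotes st tz) tz'.
Qed.

Lemma context_free_wr_mul i : context_free
  [set w | exists w1 w2, [/\ wr_lang w1, wr_lang w2,
     wr_psi w1 * S i = wr_psi w2 & w = convolution w1 w2]].
Proof.
apply: eq_context_free (context_free_steps i) => w; split.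
  move=> [t [t' [st ->]]]; have [rt rt'] := steps_represents st.
  by exists (enc t), (enc t'); split; rewrite ?wr_psi_steps //; [exists t|exists t'].
move=> [_ [_ [[t rt ->] [t' rt' ->] /(wr_psi_steps _ rt rt') st ->]]].
by exists t, t'.
Qed.

(** Every code is the first track of its convolution with the code of the product
    by the first free generator, so the language is a projection. *)
Lemma context_free_wr_lang : (0 < n)%N -> context_free wr_lang.
Proof.
move=> n_gt0; pose i : 'I_m + 'I_n := inr (Ordinal n_gt0).
apply: eq_context_free (context_free_pmap (fun x => x.1) (context_free_steps i)) => w; split.
  move=> [_ [t [t' [st ->]]] <-]; have [rt _] := steps_represents st.
  by exists t => //; apply: track1_convolution.
move=> [t rt ->]; have [[t' st] _] := steps_total i rt.
exists (convolution (enc t) (enc t')); last exact: track1_convolution.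
by exists t, t'.
Qed.

(** The code grows by at most [K] letters for each letter of the word, starting
    from the code of the unit, a single vertex. *)
Lemma word_represented (w : seq (('I_m + 'I_n) * bool)) : exists t,
  [/\ represents t, denotes t (word_eval S w) & (size (enc t) <= size u1 + K * size w)%N].
Proof.
elim/last_ind: w => [|w [i b] [t [rt tz le_t]]].
  exists (Vertex None true u1 Void Void); split.
  - by split=> //; split=> //; rewrite inE.
  - rewrite word_eval_nil; split=> b /=; rewrite ?fsfunE -?val_eqE /=.
      by case: (fg_word b).
    by case: (fg_word b); rewrite ?psi_u1.
  - by rewrite /= !cats0 size_flagged leq_addr.
rewrite size_rcons mulnS -cats1 word_eval_cat word_eval1.
have [[t1 st1] [t2 st2]] := steps_total i rt.
case: b; [exists t1|exists t2].
  have [_ r1] := steps_represents st1; have [le1 _] := steps_size st1.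
  by split=> //; [apply: steps_denotes st1 tz | lia].
have [r2 _] := steps_represents st2; have [_ le2] := steps_size st2.
split=> //; last by lia.
have t2y := wr_psi_enc r2.
by rewrite (denotes_unique tz (steps_denotes st2 t2y)) mulgK.
Qed.

Lemma wr_psi_word w : exists2 c, wr_lang c /\ wr_psi c = word_eval S w &
  (size c <= size u1 + K * size w)%N.
Proof.
have [t [rt tz le_t]] := word_represented w; exists (enc t) => //; split; first by exists t.
exact: denotes_unique (wr_psi_enc rt) tz.
Qed.

Lemma wr_psi_inj c c' : wr_lang c -> wr_lang c' -> wr_psi c = wr_psi c' -> c = c'.
Proof.
move=> [t rt ->] [t' rt' ->] E; have tz := wr_psi_enc rt; have := wr_psi_enc rt'; rewrite -E => tz'.
by rewrite (denotes_inj Lu1 psi_u1 psi_inj rt.1 rt'.1 tz tz').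
Qed.

Lemma wr_cf_representation : (0 < n)%N -> cf_cayley_representation S wr_lang wr_psi.
Proof.
move=> n_gt0; have gen_S : generates S := wreath_generates gen_g.
split=> //; [exact: context_free_wr_lang| |exact: context_free_wr_mul].
split=> // [c c'|z _]; first by rewrite !inE; apply: wr_psi_inj.
have [w <-] := gen_S z; have [c [Lc cE] _] := wr_psi_word w.
by exists c.
Qed.

Lemma wr_size_le c : wr_lang c ->
  (size c <= size u1 + K * word_length S (wr_psi c))%N.
Proof.
move=> Lc; have [w wE <-] := word_lengthP (wr_psi c) (@wreath_generates _ n _ _ gen_g).
have [c' [Lc' cE'] le_c'] := wr_psi_word w.
by rewrite (wr_psi_inj Lc Lc') // cE'.
Qed.

(** Labels are nonempty, so the constant costs of a vertex are at most
    proportional to the length of its label. *)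
Lemma tour_cost_le (R : realType) (C D : R) X t : (0 <= D)%R ->
  (forall u, L u -> ((word_length g (psi u))%:R <= C * (size u)%:R + D)%R) ->
  valid L u1 X t ->
  ((tour_cost psi g t)%:R <= (C + D + 2) * (size (enc t))%:R)%R.
Proof.
move=> D0 lenC; elim: t X => [|d mk u c IHc s IHs] X /=; first by rewrite mulr0.
move=> [_ Lu _ /IHc vc /IHs vs]; rewrite !size_cat size_flagged !natrD.
have u_gt0 : (1 <= (size u)%:R :> R)%R by rewrite ler1n; case: (u) Lu.
have := lenC u Lu; nra.
Qed.

Lemma wr_length_le (R : realType) (C D : R) c : (0 <= D)%R ->
  (forall u, L u -> ((word_length g (psi u))%:R <= C * (size u)%:R + D)%R) ->
  wr_lang c ->
  ((word_length S (wr_psi c))%:R <= (C + D + 2) * (size c)%:R - 2)%R.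
Proof.
move=> D0 lenC [t rt ->]; have [w le_w tw] := tour_root psi gen_g rt.1 rt.2.
rewrite (denotes_unique (wr_psi_enc rt) tw).
have := tour_cost_le D0 lenC rt.1; have := word_length_le S w.
rewrite -(ler_nat R) => le1; move: le_w; rewrite -(ler_nat R) natrD; lra.
Qed.

End Representation.

Local Close Scope group_scope.
Local Open Scope ring_scope.

Theorem theorem7 (R : realType) (G : groupType) (m : nat) (g : 'I_m -> G)
    (SigmaG : finType) (LG : set (seq SigmaG)) (psiG : seq SigmaG -> G)
    (N : R) (n : nat) (we : seq SigmaG) (K0 := (size we)%:R : R)
    (K := Num.max (K0 + 2 * (n%:R - 1)) N : R)
    (hpsiG : cf_cayley_representation g LG psiG)
    (hnil : ~ LG [::])
    (hN : forall u v (j : 'I_m), LG u -> LG v -> (psiG u * g j)%g = psiG v ->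
            `|(size u)%:R - (size v)%:R| <= N)
    (hn : (0 < n)%N)
    (hwe : LG we) (hpsiGwe : psiG we = 1%g) :
  exists (Sigma : finType) (L : set (seq Sigma))
         (psi : seq Sigma -> wreath G (free_group n)),
    let S := @wreath_gens G m n g in
    [/\ cf_cayley_representation S L psi,
        (forall x w, L w -> psi w = x ->
           K^-1 * (size w)%:R - K0 / K <= (word_length S x)%:R)
      & (forall C D : R, 0 < C -> 0 <= D ->
           (forall h u, LG u -> psiG u = h ->
              (word_length g h)%:R <= C * (size u)%:R + D) ->
           forall x w, L w -> psi w = x ->
             (word_length S x)%:R <= (C + D + 2) * (size w)%:R - 2)].
Proof.
have [gen_g cf_L [_ inj_psi surj_psi] cf_g] := hpsiG.
have psi_inj u v : LG u -> LG v -> psiG u = psiG v -> u = v.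
  by move=> Lu Lv; apply: inj_psi; rewrite inE.
have psi_surj h : exists2 u, LG u & psiG u = h by exact: surj_psi.
have K0_gt0 : 1 <= K0 by rewrite ler1n; case: (we) hwe.
have K0_le : K0 <= K.
  by rewrite le_max lerDl mulr_ge0 // subr_ge0 ler1n.
have K_gt0 : 0 < K by lra.
(* Gaps are natural numbers, so the real bound [K] may be rounded down. *)
pose k := Num.truncn K.
have k_le : k%:R <= K by rewrite truncn_le ltW.
have le_k i : i%:R <= K -> (i <= k)%N by rewrite truncn_ge_nat // ltW.
have gaps_k j u v : LG u -> LG v -> (psiG u * g j)%g = psiG v ->
    (gaps (convolution u v) <= k)%N.
  move=> Lu Lv uv; rewrite gaps_convolution; apply: le_k.
  have : `|(size u)%:R - (size v)%:R| <= K.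
    by rewrite le_max (hN _ _ _ Lu Lv uv) orbT.
  have [le_uv|/ltnW le_vu] := leqP (size u) (size v).
    rewrite (eqP le_uv) add0n natrB // distrC ger0_norm //.
    by rewrite subr_ge0 ler_nat.
  rewrite (eqP le_vu) addn0 natrB // ger0_norm //.
  by rewrite subr_ge0 ler_nat.
have u1_le : (size we <= k)%N by apply: le_k.
exists _, (wr_lang (n := n) LG we), (wr_psi LG we psiG); split.
- exact: (wr_cf_representation gen_g cf_L hnil hwe hpsiGwe psi_inj psi_surj cf_g gaps_k u1_le hn).
- move=> x w Lw <-.
  have := wr_size_le gen_g hnil hwe hpsiGwe psi_inj psi_surj gaps_k u1_le Lw.
  rewrite -(ler_nat R) natrD natrM => le_w.
  rewrite mulrC -mulrBl ler_pdivrMr // mulrC lerBlDl (le_trans le_w) // lerD2l.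
  by rewrite ler_wpM2r.
- move=> C D _ D0 lenC x w Lw <-; apply: (wr_length_le gen_g hnil) => // u Lu.
  exact: (lenC _ u).
Qed.
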